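(* Let $\mathbf{V}$ be a vector space over $\Bbbk$. The assignment $[n+1]\mapsto \mathsf{C}^n[\mathbf{V}]$ ($n\in\mathbb{N}_0$), together with the coface operators $\delta_i^n:\mathsf{C}^n[\mathbf{V}]\to\mathsf{C}^{n+1}[\mathbf{V}]$ ($0\le i\le n+1$) and the codegeneracies $\sigma_i^n:\mathsf{C}^{n+1}[\mathbf{V}]\to\mathsf{C}^{n}[\mathbf{V}]$ ($0\le i\le n$), defines a cosimplicial object in the category $\mathrm{Grp}$ of groups; that is, it extends to a functor $\mathbf{\Delta}\to\mathrm{Grp}$, where $\mathbf{\Delta}$ is the simplicial category.
   Context: $\Bbbk$ is $\mathbb{R}$ or $\mathbb{C}$, $\mathbb{N}_0=\{0,1,2,\dots\}$. $\mathbf{V}^{\otimes}=\bigoplus_{r\in\mathbb{N}_0}\mathbf{V}^{\otimes r}$ is the tensor algebra, with $\mathbf{V}^{\otimes 0}=\Bbbk$, product $m_\otimes$, unit map $\eta_\otimes:\Bbbk\to\mathbf{V}^\otimes$, and identity map $\mathbb{I}$. For $R=(r_1,\dots,r_n)\in\mathbb{N}_0^{n}$ put $\mathbf{V}^{\otimes R}=\mathbf{V}^{\otimes r_1}\otimes\cdots\otimes\mathbf{V}^{\otimes r_n}\subset(\mathbf{V}^\otimes)^{\otimes n}$. $\mathsf{C}^n[\mathbf{V}]$ is the group, under composition, of linear automorphisms $\psi$ of $(\mathbf{V}^\otimes)^{\otimes n}$ with $\psi(\mathbf{V}^{\otimes R})=\mathbf{V}^{\otimes R}$ for all $R\in\mathbb{N}_0^n$.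 For $n=0$, $\mathsf{C}^0[\mathbf{V}]=Aut(\Bbbk)\cong\Bbbk^\times$. Coface operators: for $n\ge1$ and $1\le i\le n$, let $m_i^n:(\mathbf{V}^\otimes)^{\otimes n+1}\to(\mathbf{V}^\otimes)^{\otimes n}$ be the map multiplying the $i$-th and $(i+1)$-th tensor factors with $m_\otimes$; it restricts to bijections $\mathbf{V}^{\otimes R}\to\mathbf{V}^{\otimes D_i^n(R)}$, where $D_i^n(R)$ is obtained from $R\in\mathbb{N}_0^{n+1}$ by adding its $i$-th and $(i+1)$-th entries. $\delta_i^n\psi$ is the unique element of $\mathsf{C}^{n+1}[\mathbf{V}]$ with $m_i^n\,\delta_i^n\psi=\psi\,m_i^n$. Also $\delta_0^n\psi=\mathbb{I}\otimes\psi$ and $\delta_{n+1}^n\psi=\psi\otimes\mathbb{I}$ for $n\ge1$. For $n=0$ and $\chi\in\mathsf{C}^0[\mathbf{V}]$ given by $1\mapsto\lambda$, $\delta_0^0\chi=\delta_1^0\chi$ is multiplication by $\lambda$ on $\mathbf{V}^\otimes$. Codegeneracies: for $0\le i\le n$ let $\eta_i^n:(\mathbf{V}^\otimes)^{\otimes n}\to(\mathbf{V}^\otimes)^{\otimes n+1}$ insert the unit $1$ (via $\eta_\otimes$) as a new factor after the $i$-th factor; $\sigma_i^n\psi$ is the unique element of $\mathsf{C}^n[\mathbf{V}]$ with $\eta_i^n\,\sigma_i^n\psi=\psi\,\eta_i^n$. $[n+1]$ denotes the ordinal with $n+1$ elements, regarded as an object of $\mathbf{\Delta}$ (Mac Lane's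 indexing; nonempty finite ordinals are meant). *)

(* Defs.v *)
From HB Require Import structures.
From mathcomp Require Import all_boot all_order all_algebra.
From mathcomp Require Import finmap boolp classical_sets functions reals.
From mathcomp Require Import complex generic_quotient ring_quotient.
From mathcomp Require Import monalg.
From mathcomp Require Import zify.

Set Implicit Arguments.
Unset Strict Implicit.
Unset Printing Implicit Defensive.

Import GRing.Theory.

Local Obligation Tactic := idtac.

Local Open Scope classical_set_scope.
Local Open Scope quotient_scope.
Local Open Scope ring_scope.

Variant scalar_kind := RealScalars | ComplexScalars.

Definition scalars (R : realType) (s : scalar_kind) : fieldType :=
  match s with RealScalars => R | ComplexScalars => R[i] end.

Section Span.
Variables (k : fieldType) (M : lmodType k).

Definition submodule (A : set M) :=
  A 0 /\ forall (a : k) x y, A x -> A y -> A (a *: x + y).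

Definition span (S : set M) : set M := smallest submodule S.

Lemma span_submodule (S : set M) : submodule (span S).
Proof.
split; first by move=> A [[A0 _] _].
move=> a x y Sx Sy A AP; have [[_ Al] _] := AP.
by apply: Al; [apply: Sx|apply: Sy].
Qed.

Lemma sub_span (S : set M) : S `<=` span S.
Proof. exact: sub_gen_smallest. Qed.

Lemma span_ind (S A : set M) : submodule A -> S `<=` A -> span S `<=` A.
Proof. exact: smallest_sub. Qed.

End Span.

(* Binary tensor product: the free module on M * N modulo bilinearity.        *)
Section Tensor.
Variables (k : fieldType) (M N : lmodType k).

Local Notation free := {malg k[(M * N)%type]}.
Local Notation gen u v := (mkmalgU ((u, v) : (M * N)%type) (1 : k) : free).

Definition bilin_rel : set free :=
  [set x | exists a u u' v,
     x = gen (a *: u + u') v - (a *: gen u v + gen u' v)] `|`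
  [set x | exists a u v v',
     x = gen u (a *: v + v') - (a *: gen u v + gen u v')].

Definition bilin_ideal : {pred free} := [pred x | `[< span bilin_rel x >]].

Lemma bilin_idealE x : span bilin_rel x <-> x \in bilin_ideal.
Proof. exact: (rwP (asboolP _)). Qed.

Lemma bilin_ideal_zmod : zmod_closed bilin_ideal.
Proof.
have [s0 sl] := span_submodule bilin_rel.
split=> [|x y /bilin_idealE sx /bilin_idealE sy]; apply/bilin_idealE => //.
by rewrite addrC -scaleN1r; apply: sl.
Qed.

HB.instance Definition _ :=
  GRing.isZmodClosed.Build free bilin_ideal bilin_ideal_zmod.

Definition tensor := Quotient.quot bilin_ideal.
HB.instance Definition _ := GRing.Zmodule.on tensor.
HB.instance Definition _ := EqQuotient.on tensor.

Lemma pi_tensorP (x y : free) :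
  \pi_tensor x = \pi_tensor y <-> span bilin_rel (x - y).
Proof.
by rewrite bilin_idealE Quotient.idealrBE; split=> [->|/eqP].
Qed.

Lemma pi_tensorD (x y : free) :
  \pi_tensor (x + y) = \pi_tensor x + \pi_tensor y.
Proof. exact: (@Quotient.pi_add _ bilin_ideal). Qed.

Definition tensor_scale (a : k) (t : tensor) : tensor :=
  \pi_tensor (a *: repr t).

Lemma pi_tensorZ (a : k) (x : free) :
  \pi_tensor (a *: x) = tensor_scale a (\pi_tensor x).
Proof.
apply/pi_tensorP; rewrite -scalerBr -[_ *: _]addr0.
have [s0 sl] := span_submodule bilin_rel; apply: sl => //.
by apply/pi_tensorP; rewrite reprK.
Qed.

Lemma tensor_scaleA a b v :
  tensor_scale a (tensor_scale b v) = tensor_scale (a * b) v.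
Proof.
by rewrite -[v]reprK -(pi_tensorZ b) -(pi_tensorZ a) -pi_tensorZ scalerA.
Qed.

Lemma tensor_scale1 : left_id 1 tensor_scale.
Proof. by move=> v; rewrite -[v]reprK -!pi_tensorZ scale1r. Qed.

Lemma tensor_scaleDr : right_distributive tensor_scale +%R.
Proof.
move=> a u v; rewrite -[u]reprK -[v]reprK.
by rewrite -pi_tensorD -!pi_tensorZ -pi_tensorD scalerDr.
Qed.

Lemma tensor_scaleDl v : {morph tensor_scale^~ v : a b / a + b}.
Proof.
by move=> a b; rewrite -[v]reprK /= -!pi_tensorZ -pi_tensorD scalerDl.
Qed.

HB.instance Definition _ := GRing.Zmodule_isLmodule.Build k tensor
  tensor_scaleA tensor_scale1 tensor_scaleDr tensor_scaleDl.

Lemma pi_tensor_linear a (x y : free) :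
  \pi_tensor (a *: x + y) = a *: \pi_tensor x + \pi_tensor y.
Proof. by rewrite pi_tensorD pi_tensorZ. Qed.

Definition tens (u : M) (v : N) : tensor := \pi_tensor (gen u v).

Lemma tens_bilinear : bilinear_for *:%R *:%R tens.
Proof.
split=> [v a u u'|u a v v'] /=; rewrite /tens -pi_tensor_linear;
  apply/pi_tensorP; apply: sub_span; [left|right].
- by exists a, u, u', v.
- by exists a, u, v, v'.
Qed.

(* The factorisation of f through tens; only meaningful for bilinear f,       *)
(* in which case it does not depend on the representative.                    *)
Definition tlift (P : lmodType k) (f : M -> N -> P) (t : tensor) : P :=
  \sum_(p <- msupp (repr t)) (repr t)@_p *: f p.1 p.2.

End Tensor.

Notation "u ⊗ v" := (tens u v) (at level 40, left associativity) : ring_scope.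

Section TensorUniversal.
Variables (k : fieldType) (M N P : lmodType k) (f : M -> N -> P).
Hypothesis f_bil : bilinear_for *:%R *:%R f.

Local Notation free := {malg k[(M * N)%type]}.

Let ev (x : free) : P := \sum_(p <- msupp x) x@_p *: f p.1 p.2.

Let evw (x : free) (d : {fset (M * N)%type}) : (msupp x `<=` d)%fset ->
  ev x = \sum_(p <- d) x@_p *: f p.1 p.2.
Proof.
move=> sxd; rewrite /ev; apply: big_fset_incl => // p _ pNx.
by rewrite mcoeff_outdom // scale0r.
Qed.

Let ev_lin (a : k) (x y : free) : ev (a *: x + y) = a *: ev x + ev y.
Proof.
pose d := (msupp x `|` msupp y `|` msupp (a *: x + y)%R)%fset.
rewrite !(@evw _ d); try by apply/fsubsetP=> p; rewrite !inE => ->; rewrite ?orbT.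
rewrite scaler_sumr -big_split /=; apply: eq_bigr => p _.
by rewrite mcoeffD mcoeffZ scalerDl scalerA.
Qed.

Let ev_gen u v : ev (mkmalgU (u, v) 1) = f u v.
Proof.
by rewrite /ev msuppU oner_eq0 big_seq_fset1 mcoeffUU scale1r.
Qed.

Let evB (x y : free) : ev (x - y) = ev x - ev y.
Proof. by rewrite [x - y]addrC -[- y]scaleN1r ev_lin scaleN1r addrC. Qed.

Let ev_pi (x : free) : tlift f (\pi_(tensor M N) x) = ev x.
Proof.
apply/eqP; rewrite -subr_eq0 -/(ev _) -evB; apply/eqP.
have: span (@bilin_rel k M N) (repr (\pi_(tensor M N) x) - x).
  by apply/pi_tensorP; rewrite reprK.
have ev0 : ev 0 = 0 by rewrite /ev msupp0 big_seq_fset0.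
apply: (@span_ind _ _ _ [set y | ev y = 0]).
  by split=> //= a y z yE zE; rewrite ev_lin yE zE scaler0 addr0.
move=> y [] /= [a [u [v [w ->]]]]; rewrite evB ev_lin !ev_gen.
- by rewrite (f_bil.1 w) subrr.
- by rewrite (f_bil.2 u) subrr.
Qed.

Lemma tliftE u v : tlift f (u ⊗ v) = f u v.
Proof. by rewrite ev_pi ev_gen. Qed.

Lemma tlift_linear : linear (tlift f).
Proof.
move=> a s t; rewrite -[s]reprK -[t]reprK.
by rewrite -pi_tensor_linear !ev_pi ev_lin.
Qed.

End TensorUniversal.

Lemma tens_span (k : fieldType) (M N : lmodType k) :
  span [set u ⊗ v | u in [set: M] & v in [set: N]] = [set: tensor M N].
Proof.
rewrite -subTset => t _; rewrite -[t]reprK.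
set S := span _; have [S0 Sl] : submodule S := span_submodule _.
rewrite [repr t]monalgE; elim/big_ind: _ => [|x y Sx Sy|p _].
- suff -> : \pi_(tensor M N) 0 = 0 by [].
  by rewrite -(scale0r (0 : {malg k[_]})) pi_tensorZ; apply: scale0r.
- by rewrite -[x]scale1r pi_tensor_linear; apply: Sl.
have -> : (<< (repr t)@_p *g p >> : {malg k[_]}) =
          (repr t)@_p *: << 1 *g p >>.
  by apply/malgP=> q; rewrite mcoeffZ !mcoeffU mulr_natr.
rewrite pi_tensorZ -[X in S X]addr0; apply: Sl => //.
by apply: sub_span; case: p => u v; exists u => //; exists v.
Qed.

Definition tmap (k : fieldType) (M M' N N' : lmodType k)
    (f : M -> M') (g : N -> N') : tensor M N -> tensor M' N' :=
  tlift (fun u v => f u ⊗ g v).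

Section TensorMaps.
Variables (k : fieldType).
Implicit Types M N P : lmodType k.

Lemma linear0_eq M N (f : M -> N) : linear f -> f 0 = 0.
Proof.
by move=> fl; have := fl (-1) 0 0; rewrite scaler0 addr0 scaleN1r addNr.
Qed.

Lemma linear_comb M N (f g : M -> N) (a : k) :
  linear f -> linear g -> linear (fun x => a *: f x + g x).
Proof.
move=> fl gl b x y; rewrite fl gl !scalerDr !scalerA mulrC -!scalerA.
by rewrite addrACA.
Qed.

Lemma tens_ext M N P (f g : tensor M N -> P) :
  linear f -> linear g -> (forall u v, f (u ⊗ v) = g (u ⊗ v)) -> f =1 g.
Proof.
move=> fl gl fg t.
have /(_ t) : [set: tensor M N] `<=` [set t | f t = g t]; last exact.
rewrite -tens_span; apply: span_ind => [|_ [u _ [v _ <-]] //=].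
split=> [|a x y /= fgx fgy]; first by rewrite /= !linear0_eq.
by rewrite fl gl fgx fgy.
Qed.

Lemma tmap_bilinear M M' N N' (f : M -> M') (g : N -> N') :
  linear f -> linear g ->
  bilinear_for *:%R *:%R (fun u v => f u ⊗ g v).
Proof.
by move=> fl gl; split=> [v a u u'|u a v v'] /=;
  rewrite ?fl ?gl ?(tens_bilinear _ _).1 ?(tens_bilinear _ _).2.
Qed.

Lemma tmapE M M' N N' (f : M -> M') (g : N -> N') u v :
  linear f -> linear g -> tmap f g (u ⊗ v) = f u ⊗ g v.
Proof. by move=> fl gl; apply: tliftE; apply: tmap_bilinear. Qed.

Lemma tmap_linear M M' N N' (f : M -> M') (g : N -> N') :
  linear f -> linear g -> linear (tmap f g).
Proof. by move=> fl gl; apply: tlift_linear; apply: tmap_bilinear. Qed.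

End TensorMaps.

(* M^{⊗n}, right-nested, with M^{⊗0} = k.                                     *)
Fixpoint tpow (k : fieldType) (M : lmodType k) (n : nat) : lmodType k :=
  match n with
  | 0 => k^o
  | n'.+1 => tensor M (tpow M n')
  end.

Section DirectSum.
Variables (k : fieldType) (E : nat -> lmodType k).

Record dsum := DSum {
  dsum_val :> forall r, E r;
  dsum_fin : exists N, forall r, (N <= r)%N -> dsum_val r = 0
}.

HB.instance Definition _ := gen_eqMixin dsum.
HB.instance Definition _ := gen_choiceMixin dsum.

Lemma dsumP (x y : dsum) : (forall r, x r = y r) -> x = y.
Proof.
case: x y => [x px] [y py] /= xy.
have {}xy : x = y by apply: functional_extensionality_dep.
by case: _ / xy py => py; congr DSum; apply: Prop_irrelevance.
Qed.

Program Definition dsum0 := @DSum (fun=> 0) _.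
Next Obligation. by exists 0. Qed.

Program Definition dsum_opp (x : dsum) := @DSum (fun r => - x r) _.
Next Obligation.
by move=> x; have [N xN] := dsum_fin x; exists N => r /xN ->; rewrite oppr0.
Qed.

Program Definition dsum_add (x y : dsum) := @DSum (fun r => x r + y r) _.
Next Obligation.
move=> x y; have [N xN] := dsum_fin x; have [N' yN'] := dsum_fin y.
exists (maxn N N') => r; rewrite geq_max => /andP[/xN -> /yN' ->].
exact: addr0.
Qed.

Program Definition dsum_scale (a : k) (x : dsum) :=
  @DSum (fun r => a *: x r) _.
Next Obligation.
by move=> a x; have [N xN] := dsum_fin x; exists N => r /xN ->; rewrite scaler0.
Qed.

Lemma dsum_addA : associative dsum_add.
Proof. by move=> x y z; apply: dsumP => r; apply: addrA. Qed.
Lemma dsum_addC : commutative dsum_add.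
Proof. by move=> x y; apply: dsumP => r; apply: addrC. Qed.
Lemma dsum_add0 : left_id dsum0 dsum_add.
Proof. by move=> x; apply: dsumP => r; apply: add0r. Qed.
Lemma dsum_addN : left_inverse dsum0 dsum_opp dsum_add.
Proof. by move=> x; apply: dsumP => r; apply: addNr. Qed.

HB.instance Definition _ :=
  GRing.isZmodule.Build dsum dsum_addA dsum_addC dsum_add0 dsum_addN.

Lemma dsum_scaleA a b x :
  dsum_scale a (dsum_scale b x) = dsum_scale (a * b) x.
Proof. by apply: dsumP => r; apply: scalerA. Qed.
Lemma dsum_scale1 : left_id 1 dsum_scale.
Proof. by move=> x; apply: dsumP => r; apply: scale1r. Qed.
Lemma dsum_scaleDr : right_distributive dsum_scale +%R.
Proof. by move=> a x y; apply: dsumP => r; apply: scalerDr. Qed.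
Lemma dsum_scaleDl x : {morph dsum_scale^~ x : a b / a + b}.
Proof. by move=> a b; apply: dsumP => r; apply: scalerDl. Qed.

HB.instance Definition _ := GRing.Zmodule_isLmodule.Build k dsum
  dsum_scaleA dsum_scale1 dsum_scaleDr dsum_scaleDl.

Program Definition dsum_inj (r : nat) (x : E r) : dsum :=
  @DSum (@dfwith nat (fun s => E s) (fun=> 0) r x) _.
Next Obligation.
move=> r x; exists r.+1 => s rs.
by rewrite dfwith_out //; apply: contraTneq rs => ->; rewrite ltnn.
Qed.

End DirectSum.

Section TensorAlgebra.
Variables (k : fieldType) (V : lmodType k).

Fixpoint concat (r s : nat) : tpow V r -> tpow V s -> tpow V (r + s) :=
  match r with
  | 0 => fun c y => (c : k) *: y
  | r'.+1 => fun x y => tlift (fun v x' => v ⊗ concat x' y) x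
  end.

Lemma concat_bilinear r s : bilinear_for *:%R *:%R (@concat r s).
Proof.
elim: r => [|r [IHl IHr]].
  split=> [y a c c'|c a y y'] /=; first by rewrite scalerDl -scalerA.
  by rewrite scalerDr !scalerA mulrC.
have catl (y : tpow V s) : bilinear_for *:%R *:%R
    (fun (v : V) (x : tpow V r) => v ⊗ concat x y).
  split=> [x a u u'|u a x x'] /=; first exact: (tens_bilinear _ _).1.
  by rewrite IHl (tens_bilinear _ _).2.
split=> [y|x a y y'] /=; first exact: tlift_linear.
have tl y := tlift_linear (catl y).
pose T (y : tpow V s) := tlift (fun (v : V) (x : tpow V r) => v ⊗ concat x y).
rewrite -/(T _) -/(T y) -/(T y').
apply: (@tens_ext _ _ _ _ (T _) (fun x => a *: T y x + T y' x)).
- exact: tl.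
- exact: linear_comb (tl y) (tl y').
- by move=> u v; rewrite /T !tliftE // IHr (tens_bilinear _ _).2.
Qed.

Lemma tcast_linear m n (e : m = n) :
  linear (fun x : tpow V m => ecast i (tpow V i) e x).
Proof. by case: _ / e. Qed.

Definition talg : lmodType k := dsum (tpow V).

Definition talg_one : talg := @dsum_inj k (tpow V) 0 (1 : k).

Program Definition talg_mul (x y : talg) : talg :=
  @DSum _ (tpow V) (fun n => \sum_(r < n.+1)
    ecast m (tpow V m) (subnKC (leq_ord r)) (concat (x r) (y (n - r)%N))) _.
Next Obligation.
move=> x y; have [N xN] := dsum_fin x; have [N' yN'] := dsum_fin y.
exists (N + N')%N => n Nn; apply: big1 => r _.
suff -> : concat (x r) (y (n - r)%N) = 0 by
  exact: (linear0_eq (tcast_linear _)).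
have [/xN -> | rN] := leqP N r.
  exact: (linear0_eq ((concat_bilinear _ _).1 _)).
rewrite yN'; first exact: (linear0_eq ((concat_bilinear _ _).2 _)).
by rewrite leq_subRL ?leq_ord // (leq_trans _ Nn) // leq_add2r ltnW.
Qed.

Lemma talg_mul_bilinear : bilinear_for *:%R *:%R talg_mul.
Proof.
split=> [y a x x'|x a y y']; apply: dsumP => n /=;
  rewrite scaler_sumr -big_split; apply: eq_bigr => r _ /=.
- by rewrite (concat_bilinear _ _).1 tcast_linear.
- by rewrite (concat_bilinear _ _).2 tcast_linear.
Qed.

(* The subspace V^{⊗R} = V^{⊗r_1} ⊗ ... ⊗ V^{⊗r_n} of (V^⊗)^{⊗n}.             *)
Fixpoint homog (n : nat) : n.-tuple nat -> set (tpow talg n) :=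
  match n with
  | 0 => fun=> setT
  | n'.+1 => fun R =>
      span [set @dsum_inj k (tpow V) (thead R) a ⊗ x
              | a in setT & x in homog (behead_tuple R)]
  end.

(* Tensor factors are numbered from 0: mul_at i multiplies the factors        *)
(* i and i+1, and unit_at i inserts 1 after the first i factors.              *)
Definition mul_first (n : nat) : tpow talg n.+2 -> tpow talg n.+1 :=
  tlift (fun u => tlift (fun v x => talg_mul u v ⊗ x)).

Lemma mul_tens_bilinear n u : bilinear_for *:%R *:%R
  (fun v (x : tpow talg n) => talg_mul u v ⊗ x).
Proof.
split=> [x a v v'|v a x x'] /=; last exact: (tens_bilinear _ _).2.
by rewrite talg_mul_bilinear.2 (tens_bilinear _ _).1.
Qed.

Lemma mul_first_bilinear n : bilinear_for *:%R *:%R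
  (fun u => tlift (fun v (x : tpow talg n) => talg_mul u v ⊗ x)).
Proof.
have tl w := tlift_linear (mul_tens_bilinear n w).
split=> [y a u u'|u] /=; last exact: tl.
apply: (tens_ext (tl _) (linear_comb a (tl u) (tl u'))) => v x.
rewrite !(tliftE (mul_tens_bilinear n _)).
by rewrite talg_mul_bilinear.1 (tens_bilinear _ _).1.
Qed.

Lemma mul_first_linear n : linear (@mul_first n).
Proof. exact: (tlift_linear (mul_first_bilinear n)). Qed.

Lemma mul_firstE n u v (x : tpow talg n) :
  mul_first (u ⊗ (v ⊗ x)) = talg_mul u v ⊗ x.
Proof.
by rewrite /mul_first (tliftE (mul_first_bilinear n)) (tliftE (mul_tens_bilinear n u)).
Qed.

Fixpoint mul_at (n : nat) : 'I_n.+1 -> tpow talg n.+2 -> tpow talg n.+1 :=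
  match n with
  | 0 => fun=> @mul_first 0
  | n'.+1 => fun i =>
      if unlift ord0 i is Some i' then tmap idfun (mul_at i')
      else @mul_first n'.+1
  end.

Lemma mul_at_linear n (i : 'I_n.+1) : linear (mul_at i).
Proof.
elim: n i => [|n IHn] i /=; first exact: (@mul_first_linear 0).
by case: unliftP => [j _|_]; [apply: tmap_linear|exact: (@mul_first_linear n.+1)].
Qed.

Fixpoint unit_at (n : nat) : 'I_n.+1 -> tpow talg n -> tpow talg n.+1 :=
  match n with
  | 0 => fun _ x => talg_one ⊗ x
  | n'.+1 => fun i =>
      if unlift ord0 i is Some i' then tmap idfun (unit_at i')
      else fun x => talg_one ⊗ x
  end.

Lemma unit_at_linear n (i : 'I_n.+1) : linear (unit_at i).
Proof.
elim: n i => [|n IHn] i /=; first exact: ((tens_bilinear _ _).2 _).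
by case: unliftP => [j _|_]; [apply: tmap_linear|exact: ((tens_bilinear _ _).2 _)].
Qed.

(* x ⊗ w in W^{⊗n} ⊗ W = W^{⊗n+1}, for W the tensor algebra.                   *)
Fixpoint tsnoc (n : nat) : tpow talg n -> talg -> tpow talg n.+1 :=
  match n with
  | 0 => fun c w => w ⊗ c
  | n'.+1 => fun x w => tmap idfun (fun y => tsnoc y w) x
  end.

Lemma tsnoc_linear n (w : talg) : linear ((@tsnoc n)^~ w).
Proof.
elim: n => [|n IHn] /=; first exact: (tens_bilinear _ _).2.
exact: tmap_linear.
Qed.

End TensorAlgebra.

Arguments talg_one {k} V.
Arguments homog {k} V {n} R.
Arguments mul_at {k} V {n} i x.
Arguments unit_at {k} V {n} i x.

Section CosimplicialGroup.
Variables (k : fieldType) (V : lmodType k).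

Local Notation W n := (tpow (talg V) n).

Definition graded_auto (n : nat) : set (W n -> W n) :=
  [set psi | [/\ linear psi, bijective psi &
                 forall R : n.-tuple nat, psi @` homog V R = homog V R]].

(* C^n[V], a group under composition.                                         *)
Definition cgroup (n : nat) : Type := @graded_auto n.

HB.instance Definition _ n := Choice.on (cgroup n).

Definition cgroup_fun n (psi : cgroup n) : W n -> W n := val psi.
Coercion cgroup_fun : cgroup >-> Funclass.

Section Group.
Variable n : nat.
Implicit Types psi phi : cgroup n.

Definition cgroup_mk (psi : W n -> W n) (p : @graded_auto n psi) : cgroup n :=
  exist _ psi (mem_set p).

Lemma cgroup_ext psi phi : psi =1 phi -> psi = phi.
Proof. by move=> e; apply/val_inj/funext. Qed.

Lemma cgroupP psi : @graded_auto n psi.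
Proof. exact: set_mem (valP psi). Qed.

Lemma graded_auto_id : @graded_auto n idfun.
Proof. by split; [|exists idfun|move=> R; rewrite image_id]. Qed.

Lemma graded_auto_comp psi phi : @graded_auto n (psi \o phi).
Proof.
have [pl pb pR] := cgroupP psi; have [fl fb fR] := cgroupP phi.
split=> [a x y /=||R]; first by rewrite fl pl.
  exact: bij_comp.
by rewrite -image_comp fR pR.
Qed.

Definition cgroup_invfun psi (y : W n) : W n := xget 0 [set x | psi x = y].

Lemma cgroup_invfunK psi : cancel (cgroup_invfun psi) psi.
Proof.
move=> y; have [_ [g _ gK] _] := cgroupP psi.
exact: (@xgetPex _ 0 [set x | psi x = y] (ex_intro _ (g y) (gK y))).
Qed.

Lemma cgroup_funK psi : cancel psi (cgroup_invfun psi).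
Proof.
have [_ pb _] := cgroupP psi.
by move=> x; apply: (bij_inj pb); rewrite cgroup_invfunK.
Qed.

Lemma graded_auto_inv psi : @graded_auto n (cgroup_invfun psi).
Proof.
have [pl pb pR] := cgroupP psi; split=> [a x y||R].
- by apply: (bij_inj pb); rewrite pl !cgroup_invfunK.
- by exists psi; [exact: cgroup_invfunK|exact: cgroup_funK].
- rewrite -{1}(pR R) image_comp.
  by rewrite (_ : _ \o _ = idfun) ?image_id //; apply/funext/cgroup_funK.
Qed.

Definition cgroup_one := cgroup_mk graded_auto_id.
Definition cgroup_mul psi phi := cgroup_mk (graded_auto_comp psi phi).
Definition cgroup_inv psi := cgroup_mk (graded_auto_inv psi).

Lemma cgroup_mulA : associative cgroup_mul.
Proof. by move=> ? ? ?; apply: cgroup_ext. Qed.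
Lemma cgroup_mul1 : left_id cgroup_one cgroup_mul.
Proof. by move=> ?; apply: cgroup_ext. Qed.
Lemma cgroup_1mul : right_id cgroup_one cgroup_mul.
Proof. by move=> ?; apply: cgroup_ext. Qed.
Lemma cgroup_mulV : left_inverse cgroup_one cgroup_inv cgroup_mul.
Proof. by move=> psi; apply: cgroup_ext => x; apply: cgroup_funK. Qed.
Lemma cgroup_Vmul : right_inverse cgroup_one cgroup_inv cgroup_mul.
Proof. by move=> psi; apply: cgroup_ext => x; apply: cgroup_invfunK. Qed.

HB.instance Definition _ := isGroup.Build (cgroup n)
  cgroup_mulA cgroup_mul1 cgroup_1mul cgroup_mulV cgroup_Vmul.

End Group.

(* is_coface i psi psi' : psi' satisfies the equation that determines         *)
(* δ_i psi. For 1 <= i <= n the operator m_i is mul_at j with i = j + 1.      *)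
Definition is_coface (n : nat) :
    'I_n.+2 -> cgroup n -> cgroup n.+1 -> Prop :=
  match n with
  | 0 => fun i chi psi' => forall x, psi' x = (chi (1 : k) : k) *: x
  | n'.+1 => fun i psi psi' =>
      [/\ i = ord0 -> forall w x, psi' (w ⊗ x) = w ⊗ psi x,
          i = ord_max -> forall x w, psi' (tsnoc x w) = tsnoc (psi x) w
        & forall j : 'I_n'.+1, i = j.+1 :> nat ->
            forall x, mul_at V j (psi' x) = psi (mul_at V j x)]
  end.

Definition is_codegeneracy (n : nat) (i : 'I_n.+1)
    (psi : cgroup n.+1) (psi' : cgroup n) : Prop :=
  forall x, unit_at V i (psi' x) = psi (unit_at V i x).

End CosimplicialGroup.

(* The generators of Δ: lift i is the injection 'I_n.+1 -> 'I_n.+2 missing i, *)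
(* and sdeg i is the surjection 'I_n.+2 -> 'I_n.+1 taking the value i twice.  *)
Lemma lift_nondecreasing n (i : 'I_n.+2) :
  {homo lift i : j l / (j <= l)%O}.
Proof. by move=> j l; rewrite !leEord /= leq_bump2. Qed.

HB.instance Definition _ n (i : 'I_n.+2) :=
  Order.isOrderMorphism.Build _ 'I_n.+1 _ 'I_n.+2 (lift i)
    (@lift_nondecreasing n i).

Definition sdeg (n : nat) (i : 'I_n.+1) (j : 'I_n.+2) : 'I_n.+1 :=
  inord (unbump i j).

Lemma sdeg_nondecreasing n (i : 'I_n.+1) :
  {homo sdeg i : j l / (j <= l)%O}.
Proof.
move=> j l; rewrite !leEord /sdeg /= => jl.
have lti (j' : 'I_n.+2) : (unbump i j' < n.+1)%N.
  by have := ltn_ord j'; have := ltn_ord i; rewrite /unbump; lia.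
by rewrite !inordK ?lti //; rewrite /unbump; lia.
Qed.

HB.instance Definition _ n (i : 'I_n.+1) :=
  Order.isOrderMorphism.Build _ 'I_n.+2 _ 'I_n.+1 (sdeg i)
    (@sdeg_nondecreasing n i).

(* A functor Δ -> Grp whose value on [n+1] is G n.                            *)
Record cosimplicial (G : nat -> groupType) := Cosimplicial {
  cs_map : forall m n,
    {omorphism 'I_m.+1 -> 'I_n.+1} -> {multiplicative G m -> G n};
  cs_id : forall n (x : G n), @cs_map n n idfun x = x;
  cs_comp : forall l m n (f : {omorphism 'I_l.+1 -> 'I_m.+1})
      (g : {omorphism 'I_m.+1 -> 'I_n.+1}) (x : G l),
    cs_map (g \o f) x = cs_map g (cs_map f x)
}.

(* Main.v *)
Require Import Defs.
From HB Require Import structures.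
From mathcomp Require Import all_boot all_order all_algebra.
From mathcomp Require Import boolp classical_sets reals.
From mathcomp Require Import zify.

(** Write W for the tensor algebra, W_d for its degree d part ([piece d]), and
    M : W^{⊗n} -> W for the product of all tensor factors ([mulall]).  On the
    summand V^{⊗R} the map M is a bijection onto W_|R|, with inverse [sect R].
    An element psi of C^n[V] is therefore the same thing as a family, indexed by
    the multidegrees R, of linear automorphisms
    [component psi R] = M psi (sect R) of W_|R|.

    In these terms all operators of the cosimplicial group have one common
    description.  Let f : {0..m} -> {0..n} be monotone and let R have n entries.
    Cut R at the positions f 0 <= ... <= f m: this leaves a prefix of total
    degree p, m blocks with sums S = (s_1, ..., s_m) ([pullback f R]), and a
    suffix of total degree q.  The pushforward of psi along f is
      (f_* psi)_R = id ⊗ psi_S ⊗ id   on   W_p ⊗ W_|S| ⊗ W_q = W_|R|,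
    that is, u w v is sent to u psi_S(w) v ([is_pushforward]).  This determines
    f_* psi because products u w v span W_|R|, and it is well defined because
    multiplication W_r ⊗ W_s -> W_{r+s} is an isomorphism ([mul_lift],
    [piece_ind]).

    Functoriality is associativity of the product of W: cutting R along g and
    then its block sums along f amounts to cutting R along g \o f
    ([pullback_comp], [prefix_degree_comp], [suffix_degree_comp]), whence
    g_* f_* = (g \o f)_* ([pushforward_comp]).

    It remains to recognise the generators.  The maps m_i and η_i preserve M,
    and they carry V^{⊗R} into V^{⊗S} with S the pullback of R along the
    corresponding face or degeneracy map, whose prefix and suffix are empty; as
    M is injective on V^{⊗S}, the pushforward satisfies the defining equation
    ([pushforward_intertwine]), and M-invariance also makes its solution unique
    ([intertwine_unique]).  For the two outer faces the prefix or the suffix is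
    a single factor, which gives id ⊗ psi and psi ⊗ id; from C^0 they give
    multiplication by a scalar. *)

Set Implicit Arguments.
Unset Strict Implicit.
Unset Printing Implicit Defensive.

Import Order.Theory GRing.Theory.

Local Open Scope classical_set_scope.
Local Open Scope ring_scope.

(** * Linear maps and submodules *)

Section Submodules.
Variable k : fieldType.
Implicit Types M N P : lmodType k.

Lemma linear_comp M N P (f : N -> P) (g : M -> N) :
  linear f -> linear g -> linear (f \o g).
Proof. by move=> fl gl a x y /=; rewrite gl fl. Qed.

Lemma linear_scale M N (f : M -> N) a x : linear f -> f (a *: x) = a *: f x.
Proof. by move=> fl; rewrite -[a *: x]addr0 fl (linear0_eq fl) addr0. Qed.

Lemma submodule_scale M (A : set M) a x : submodule A -> A x -> A (a *: x).
Proof. by move=> [A0 Al] Ax; rewrite -[a *: x]addr0; apply: Al. Qed.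

Lemma submodule_eq M N (f g : M -> N) :
  linear f -> linear g -> submodule [set x | f x = g x].
Proof.
move=> fl gl; split=> [|a x y /= fgx fgy] /=; first by rewrite !linear0_eq.
by rewrite fl gl fgx fgy.
Qed.

Lemma submodule_preimage M N (f : M -> N) (A : set N) :
  linear f -> submodule A -> submodule (f @^-1` A).
Proof.
move=> fl [A0 Al]; split=> [|a x y /= Ax Ay]; first by rewrite /= linear0_eq.
by rewrite /= fl; apply: Al.
Qed.

Lemma tens_ind M N (A : set (tensor M N)) :
  submodule A -> (forall u v, A (u ⊗ v)) -> forall t, A t.
Proof.
move=> sA Auv t; have : [set: tensor M N] `<=` A; last exact.
by rewrite -tens_span; apply: span_ind => // _ [u _ [v _ <-]].
Qed.

Lemma tens0r M N (u : M) : u ⊗ (0 : N) = 0.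
Proof. exact: linear0_eq ((tens_bilinear _ _).2 u). Qed.

Lemma tmap_tens_bilinear M N P :
  bilinear_for *:%R *:%R
    (fun (u : M) (t : tensor N P) => tmap (tens u) idfun t).
Proof.
have ul (u : M) : linear (tmap (tens u) (@idfun P) : tensor N P -> _).
  by apply: tmap_linear => //; apply: (tens_bilinear _ _).2.
split=> [t a u u'|u] /=; last exact: ul.
have ulE (x : M) v (w : P) : tmap (tens x) idfun (v ⊗ w) = x ⊗ v ⊗ w.
  by apply: tmapE => //; apply: (tens_bilinear _ _).2.
apply: (tens_ext (ul _) (linear_comb a (ul u) (ul u'))) => v w.
by rewrite !ulE !(tens_bilinear _ _).1.
Qed.

End Submodules.

(** * The tensor algebra as a graded algebra *)
Section TensorAlgebraTheory.
Variables (k : fieldType) (V : lmodType k).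

Local Notation W := (talg V).
Local Notation ι r := (@dsum_inj k (tpow V) r).
Local Infix "⋆" := (@talg_mul k V) (at level 40, left associativity).

Lemma dsum_inj_in r (x : tpow V r) : ι r x r = x.
Proof. by rewrite /= dfwith_in. Qed.

Lemma dsum_inj_out r s (x : tpow V r) : s != r -> ι r x s = 0.
Proof. by move=> sr; rewrite /= dfwith_out // eq_sym. Qed.

Lemma dsum_inj_linear r : linear (ι r).
Proof.
move=> a x y; apply: dsumP => n /=.
have [->|nr] := eqVneq n r; first by rewrite !dfwith_in.
by rewrite !dfwith_out 1?eq_sym // scaler0 addr0.
Qed.

#[local] Opaque dsum_inj.

(** Equality in the direct sum replaces equality up to a cast between tpow V m
    and tpow V n when the degrees agree only propositionally; this lemma lets
    such equalities be proved by induction on the degree. *)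
Lemma dsum_inj_cons m n (x : tpow V m) (y : tpow V n) (v : V) :
  ι m x = ι n y -> ι m.+1 (v ⊗ x) = ι n.+1 (v ⊗ y).
Proof.
move=> xy; have [mn|mn] := eqVneq m n.
  case: _ / mn y xy => y xy.
  by rewrite -[x]dsum_inj_in xy dsum_inj_in.
(* If the degrees differ, then x and y vanish. *)
rewrite -[x]dsum_inj_in xy dsum_inj_out // -[y]dsum_inj_in -xy.
rewrite dsum_inj_out 1?eq_sym // !tens0r.
by rewrite !(linear0_eq (@dsum_inj_linear _)).
Qed.

Lemma talg_ind (A : set W) :
  submodule A -> (forall r a, A (ι r a)) -> forall w, A w.
Proof.
move=> [A0 Al] Ainj w; have [N wN] := dsum_fin w.
suff -> : w = \sum_(r < N) ι r (w r).
  elim/big_ind: _ => // x y Ax Ay; rewrite -[x]scale1r; exact: Al.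
apply: dsumP => n.
have sE (I : Type) (s : seq I) (f : I -> W) :
    (\sum_(i <- s) f i) n = \sum_(i <- s) f i n.
  by elim/big_ind2: _ => // x x' y y' <- <-.
rewrite sE; have [Nn|nN] := leqP N n.
  rewrite wN // big1 // => r _; rewrite dsum_inj_out //.
  by rewrite gtn_eqF // (leq_trans (ltn_ord r)).
rewrite (bigD1 (Ordinal nN)) //= dsum_inj_in big1 ?addr0 // => r rn.
by rewrite dsum_inj_out // eq_sym.
Qed.

Lemma concat_cons r s (v : V) (x : tpow V r) (y : tpow V s) :
  @concat k V r.+1 s (v ⊗ x) y = v ⊗ concat x y.
Proof.
rewrite /= tliftE //; split=> [z a u u'|u a z z'] /=.
  exact: (tens_bilinear _ _).1.
by rewrite (concat_bilinear _ _ _).1 (tens_bilinear _ _).2.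
Qed.

Lemma talg_mul_inj r s (x : tpow V r) (y : tpow V s) :
  ι r x ⋆ ι s y = ι (r + s) (concat x y).
Proof.
apply: dsumP => n; rewrite [LHS]/=.
have castE m (e : m = n) (z : tpow V m) :
    ecast i (tpow V i) e z = ι m z n.
  by case: _ / e; rewrite dsum_inj_in.
under eq_bigr do rewrite castE.
(* Only the term (r, s) of the convolution sum defining the product survives. *)
have term0 i j : (i, j) != (r, s) -> concat (ι r x i) (ι s y j) = 0.
  rewrite xpair_eqE negb_and => /orP[ir|js].
    by rewrite (dsum_inj_out _ ir); apply: (linear0_eq ((concat_bilinear _ _ _).1 _)).
  by rewrite (dsum_inj_out _ js); apply: (linear0_eq ((concat_bilinear _ _ _).2 _)).
have inj0 i : ι i 0 n = 0 by rewrite (linear0_eq (@dsum_inj_linear _)).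
have [rn|nr] := leqP r n; last first.
  rewrite big1 => [|i _]; last first.
    by rewrite term0 ?inj0 // xpair_eqE negb_and ltn_eqF // (leq_trans _ nr).
  by rewrite dsum_inj_out // ltn_eqF // ltn_addr.
rewrite (bigD1 (Ordinal (rn : (r < n.+1)%N))) //= big1 ?addr0 => [|i]; last first.
  by rewrite -val_eqE /= => ir; rewrite term0 ?inj0 // xpair_eqE negb_and ir.
have [nrs|nrs] := eqVneq (n - r)%N s.
  by case: _ / nrs y {term0} => y; rewrite !dsum_inj_in.
rewrite term0 ?inj0; last by rewrite xpair_eqE negb_and nrs orbT.
by rewrite dsum_inj_out //; move: nrs; lia.
Qed.

Lemma concat_linearl r s (y : tpow V s) : linear (fun x : tpow V r => concat x y).
Proof. exact: (concat_bilinear _ _ _).1. Qed.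

Lemma concatA r s t (x : tpow V r) (y : tpow V s) (z : tpow V t) :
  ι (r + s + t) (concat (concat x y) z) = ι (r + (s + t)) (concat x (concat y z)).
Proof.
elim: r x => [|r IHr] x.
  by rewrite /= (linear_scale _ _ (@concat_linearl _ _ z)).
pose f (u : tpow V r.+1) := ι (r.+1 + s + t) (concat (concat u y) z).
pose g (u : tpow V r.+1) := ι (r.+1 + (s + t)) (concat u (concat y z)).
rewrite -/(f x) -/(g x).
apply: (@tens_ext _ _ _ _ f g) => [||v {}x].
- apply: (linear_comp (@dsum_inj_linear _)).
  exact: (linear_comp (@concat_linearl _ t z) (@concat_linearl r.+1 s y)).
- exact: (linear_comp (@dsum_inj_linear _) (@concat_linearl r.+1 _ (concat y z))).
by rewrite /f /g !concat_cons; apply: dsum_inj_cons.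
Qed.

Lemma concatr1 r (x : tpow V r) : ι (r + 0) (@concat k V r 0 x (1 : k)) = ι r x.
Proof.
elim: r x => [|r IHr] x; first by rewrite /= [_ *: _]mulr1.
pose f (u : tpow V r.+1) := ι (r.+1 + 0) (@concat k V r.+1 0 u (1 : k)).
rewrite -/(f x); apply: (@tens_ext _ _ _ _ f (ι r.+1)) => [||v {}x].
- exact: (linear_comp (@dsum_inj_linear _) (@concat_linearl r.+1 0 (1 : k))).
- exact: (@dsum_inj_linear r.+1).
by rewrite /f concat_cons; apply: dsum_inj_cons.
Qed.

Lemma talg_ext (P : lmodType k) (f g : W -> P) : linear f -> linear g ->
  (forall r a, f (ι r a) = g (ι r a)) -> f =1 g.
Proof. by move=> fl gl fg; apply: talg_ind; [apply: submodule_eq|]. Qed.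

Lemma talg_mull_linear v : linear (fun u : W => u ⋆ v).
Proof. exact: (talg_mul_bilinear V).1. Qed.

Lemma talg_mulr_linear u : linear (talg_mul (V := V) u).
Proof. exact: (talg_mul_bilinear V).2. Qed.

Lemma talg_scalel a u v : (a *: u) ⋆ v = a *: (u ⋆ v).
Proof. exact: linear_scale (talg_mull_linear v). Qed.

Lemma talg_scaler a u v : u ⋆ (a *: v) = a *: (u ⋆ v).
Proof. exact: linear_scale (talg_mulr_linear u). Qed.

Lemma talg_mulA u v w : u ⋆ (v ⋆ w) = u ⋆ v ⋆ w.
Proof.
move: u; apply: talg_ext => [||r a].
- exact: talg_mull_linear.
- exact: linear_comp (@talg_mull_linear w) (@talg_mull_linear v).
move: v; apply: talg_ext => [||s b].
- exact: linear_comp (@talg_mulr_linear _) (@talg_mull_linear w).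
- exact: linear_comp (@talg_mull_linear w) (@talg_mulr_linear _).
move: w; apply: talg_ext => [||t c].
- exact: linear_comp (@talg_mulr_linear _) (@talg_mulr_linear _).
- exact: talg_mulr_linear.
by rewrite !talg_mul_inj concatA.
Qed.

Lemma talg_mul1 : left_id (talg_one V) (talg_mul (V := V)).
Proof.
apply: (talg_ext (g := id)) => [|//|r a]; first exact: talg_mulr_linear.
by rewrite talg_mul_inj /= scale1r.
Qed.

Lemma talg_1mul : right_id (talg_one V) (talg_mul (V := V)).
Proof.
apply: (talg_ext (g := id)) => [|//|r a]; first exact: talg_mull_linear.
by rewrite talg_mul_inj concatr1.
Qed.

Definition piece d : set W := range (ι d).

Lemma piece_submodule d : submodule (piece d).
Proof.
split; first by exists 0 => //; apply: linear0_eq (@dsum_inj_linear d).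
by move=> a _ _ [x _ <-] [y _ <-]; exists (a *: x + y); rewrite ?dsum_inj_linear.
Qed.

Lemma piece_inj d (x : tpow V d) : piece d (ι d x).
Proof. by exists x. Qed.

Lemma piece0P w : piece 0 w -> exists a : k, w = a *: talg_one V.
Proof.
case=> a _ <-; exists a; rewrite -(linear_scale _ _ (@dsum_inj_linear 0)).
by congr (ι 0 _); rewrite [RHS]mulr1.
Qed.

Lemma piece_mul r s u v : piece r u -> piece s v -> piece (r + s) (u ⋆ v).
Proof. by move=> [a _ <-] [b _ <-]; rewrite talg_mul_inj; apply: piece_inj. Qed.

Lemma piece_one : piece 0 (talg_one V).
Proof. exact: piece_inj. Qed.

(** Multiplication W_r ⊗ W_s -> W_{r+s} is onto. *)
Lemma piece_ind r s (A : set W) : submodule A ->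
  (forall u v, piece r u -> piece s v -> A (u ⋆ v)) ->
  forall w, piece (r + s) w -> A w.
Proof.
move=> sA Auv _ [x _ <-].
have sB := submodule_preimage (@dsum_inj_linear (r + s)) sA.
have Bcat a b : (ι (r + s) @^-1` A) (@concat k V r s a b).
  by rewrite /= -talg_mul_inj; apply: Auv; apply: piece_inj.
rewrite -[A _]/((ι (r + s) @^-1` A) x); move: (ι (r + s) @^-1` A) sB Bcat.
elim: r x {Auv} => [|r IHr] x B sB Bcat.
  by have := Bcat (1 : k) x; rewrite /= scale1r.
move: x; apply: tens_ind => // v x; apply: (IHr x (tens v @^-1` B)).
  exact: submodule_preimage ((tens_bilinear _ _).2 v) sB.
by move=> a b /=; rewrite -concat_cons; apply: Bcat.
Qed.

(** The inverse of concatenation: splits off the first r factors. *)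
Fixpoint tpow_split r s : tpow V (r + s) -> tensor (tpow V r) (tpow V s) :=
  match r with
  | 0 => fun y => @tens k (tpow V 0) (tpow V s) (1 : k) y
  | r'.+1 =>
      tlift (fun v y => tmap (tens v) idfun (@tpow_split r' s y))
  end.

Lemma tpow_split_cons_bilinear r s (g : tpow V (r + s) -> tensor (tpow V r) (tpow V s)) :
  linear g -> bilinear_for *:%R *:%R
    (fun (v : V) y => tmap (tens v) idfun (g y) : tensor (tpow V r.+1) _).
Proof.
move=> gl; split=> [y a v v'|v a y y'] /=.
  exact: (tmap_tens_bilinear _ _ _).1.
by rewrite gl; apply: (tmap_tens_bilinear _ _ _).2.
Qed.

Lemma tpow_split_linear r s : linear (@tpow_split r s).
Proof.
elim: r => [|r IHr]; first exact: (tens_bilinear (tpow V 0) (tpow V s)).2.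
exact: tlift_linear (tpow_split_cons_bilinear IHr).
Qed.

Lemma tpow_split_concat r s (a : tpow V r) (b : tpow V s) :
  tpow_split (concat a b) = a ⊗ b.
Proof.
elim: r a => [|r IHr] a /=.
  rewrite (linear_scale _ _ ((tens_bilinear (tpow V 0) (tpow V s)).2 (1 : k))).
  by rewrite -(linear_scale _ _ ((tens_bilinear (tpow V 0) (tpow V s)).1 b)) [_ *: _]mulr1.
pose f (u : tpow V r.+1) := @tpow_split r.+1 s (concat u b).
rewrite -/(tpow_split (concat a b)) -/(f a); move: a.
apply: (@tens_ext _ _ _ _ f (@tens k (tpow V r.+1) _ ^~ b)) => [||v {}a].
- exact: (linear_comp (@tpow_split_linear r.+1 s) (@concat_linearl r.+1 s b)).
- exact: (tens_bilinear _ _).1.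
rewrite /f concat_cons /= (tliftE (tpow_split_cons_bilinear (@tpow_split_linear r s))) IHr.
by rewrite tmapE //; apply: (tens_bilinear _ _).2.
Qed.

(** Multiplication W_r ⊗ W_s -> W_{r+s} is bijective, so a bilinear map on
    W_r × W_s is the restriction of a linear map along the product.  The linear
    map is defined on all of W, by first projecting to degree r + s. *)
Section MulLift.
Variables (P : lmodType k) (r s : nat) (f : W -> W -> P).
Hypothesis f_bil : bilinear_for *:%R *:%R f.

Definition mul_lift (w : W) : P :=
  tlift (fun a b => f (ι r a) (ι s b)) (tpow_split (w (r + s)%N)).

Let f_inj_bil : bilinear_for *:%R *:%R (fun a b => f (ι r a) (ι s b)).
Proof.
split=> [b a x x'|x a b b'] /=; rewrite dsum_inj_linear.
  by rewrite f_bil.1.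
by rewrite f_bil.2.
Qed.

Lemma mul_lift_linear : linear mul_lift.
Proof.
move=> a u v; rewrite /mul_lift /= tpow_split_linear.
exact: tlift_linear.
Qed.

Lemma mul_liftE u v : piece r u -> piece s v -> mul_lift (u ⋆ v) = f u v.
Proof.
move=> [a _ <-] [b _ <-].
by rewrite /mul_lift talg_mul_inj dsum_inj_in tpow_split_concat tliftE.
Qed.

Lemma mul_lift_ind (A : set P) (w : W) : submodule A ->
  (forall u v, piece r u -> piece s v -> A (f u v)) -> A (mul_lift w).
Proof.
move=> sA Af; rewrite /mul_lift; move: (tpow_split _).
apply: (tens_ind (A := tlift _ @^-1` A)) => [|a b].
  exact: submodule_preimage (tlift_linear f_inj_bil) sA.
by rewrite /= tliftE //; apply: Af; apply: piece_inj.
Qed.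

End MulLift.
End TensorAlgebraTheory.

Arguments dsum_inj_linear {k V} r.
Arguments piece_submodule {k V} d.

(** * The total product and the multigraded pieces of the tensor powers *)
Section TensorPowers.
Variables (k : fieldType) (V : lmodType k).

Local Notation W := (talg V).
Local Notation ι r := (@dsum_inj k (tpow V) r).
Local Infix "⋆" := (@talg_mul k V) (at level 40, left associativity).

#[local] Opaque dsum_inj.

Fixpoint mulall n : tpow W n -> W :=
  match n with
  | 0 => fun c => (c : k) *: talg_one V
  | n'.+1 => tlift (fun w x => w ⋆ @mulall n' x)
  end.

Let mulall_cons_bilinear n (g : tpow W n -> W) : linear g ->
  bilinear_for *:%R *:%R (fun w x => w ⋆ g x).
Proof.
move=> gl; split=> [x a w w'|w a x x'] /=; first exact: talg_mull_linear.
by rewrite gl talg_mulr_linear.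
Qed.

Lemma mulall_linear n : linear (@mulall n).
Proof.
elim: n => [|n IHn]; last exact: tlift_linear (mulall_cons_bilinear IHn).
by move=> a x y /=; rewrite scalerDl scalerA.
Qed.

Lemma mulall0 (c : tpow W 0) : mulall c = (c : k) *: talg_one V.
Proof. by []. Qed.

Lemma mulall_cons n w (x : tpow W n) : @mulall n.+1 (w ⊗ x) = w ⋆ mulall x.
Proof. exact: tliftE (mulall_cons_bilinear (@mulall_linear n)) _ _. Qed.

Arguments mulall : simpl never.

Lemma sumn_tuple n (R : n.+1.-tuple nat) :
  sumn R = (thead R + sumn (behead_tuple R))%N.
Proof. by case/tupleP: R => r R; rewrite theadE. Qed.

Lemma homog_submodule n (R : n.-tuple nat) : submodule (homog V R).
Proof. by case: n R => [|n] R; [split|apply: span_submodule]. Qed.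

Lemma homog_cons n (R : n.+1.-tuple nat) w (x : tpow W n) :
  piece (thead R) w -> homog V (behead_tuple R) x -> homog V R (w ⊗ x).
Proof.
by move=> [a _ <-] Rx /=; apply: Defs.sub_span; exists a => //; exists x.
Qed.

Lemma homog_ind n (R : n.+1.-tuple nat) (A : set (tpow W n.+1)) : submodule A ->
  (forall w x, piece (thead R) w -> homog V (behead_tuple R) x -> A (w ⊗ x)) ->
  homog V R `<=` A.
Proof.
move=> sA Awx; apply: span_ind => // _ [a _ [x Rx <-]].
by apply: Awx => //; apply: piece_inj.
Qed.

Lemma behead_cons_tuple n r (R : n.-tuple nat) :
  behead_tuple [tuple of r :: R] = R.
Proof. exact: val_inj. Qed.

Lemma homog_total n (A : set (tpow W n)) : submodule A ->
  (forall R, homog V R `<=` A) -> forall x, A x.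
Proof.
elim: n A => [|n IHn] A sA RA; first by move=> x; apply: (RA [tuple]).
apply: tens_ind => // u x; move: u.
refine (talg_ind (submodule_preimage ((tens_bilinear W _).1 x) sA) _) => r a.
rewrite [X in X _]/preimage /=.
move: x; apply: (IHn (tens (ι r a) @^-1` A)) => [|R x Rx].
  exact: submodule_preimage ((tens_bilinear _ _).2 _) sA.
apply: (RA [tuple of r :: R]); apply: homog_cons.
  by rewrite theadE; apply: piece_inj.
by rewrite behead_cons_tuple.
Qed.

Lemma homog_ext n (P : lmodType k) (f g : tpow W n -> P) :
  linear f -> linear g ->
  (forall R x, homog V R x -> f x = g x) -> f =1 g.
Proof. by move=> fl gl fg; apply: homog_total; [apply: submodule_eq|]. Qed.

Lemma mulall_homog n (R : n.-tuple nat) x :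
  homog V R x -> piece (sumn R) (mulall x).
Proof.
elim: n R x => [|n IHn] R x.
  by rewrite (tuple0 R) => _; apply: submodule_scale (piece_submodule 0) (piece_one V).
apply: (homog_ind (A := @mulall n.+1 @^-1` piece (sumn R))) => [|w {}x pw Rx].
  exact: submodule_preimage (@mulall_linear n.+1) (piece_submodule _).
by rewrite /= mulall_cons sumn_tuple; apply: piece_mul; last exact: IHn.
Qed.

(** The inverse of M between W_|R| and V^{⊗R}: split off the first entry of R
    and recurse. *)
Fixpoint sect n : n.-tuple nat -> W -> tpow W n :=
  match n with
  | 0 => fun _ w => w 0
  | n'.+1 => fun R =>
      mul_lift (thead R) (sumn (behead_tuple R))
        (fun u w => u ⊗ @sect n' (behead_tuple R) w)
  end.

Let sect_cons_bilinear n (g : W -> tpow W n) : linear g ->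
  bilinear_for *:%R *:%R (fun (u w : W) => u ⊗ g w).
Proof. by move=> gl; apply: (tmap_bilinear (f := id)). Qed.

Lemma sect_linear n (R : n.-tuple nat) : linear (sect R).
Proof.
elim: n R => [|n IHn] R //=.
exact: mul_lift_linear (sect_cons_bilinear (IHn _)).
Qed.

Lemma sect_homog n (R : n.-tuple nat) w : homog V R (sect R w).
Proof.
elim: n R w => [//|n IHn] R w.
apply: (mul_lift_ind (A := homog V R) (sect_cons_bilinear (@sect_linear _ _)) w).
  exact: homog_submodule.
by move=> u v pu _; apply: homog_cons.
Qed.

Lemma sect0 (R : 0.-tuple nat) w : sect R w = w 0 :> (k : Type).
Proof. by []. Qed.

Lemma sect_mul n (R : n.+1.-tuple nat) u v :
  piece (thead R) u -> piece (sumn (behead_tuple R)) v ->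
  sect R (u ⋆ v) = u ⊗ sect (behead_tuple R) v.
Proof. exact: mul_liftE (sect_cons_bilinear (@sect_linear _ _)) _ _. Qed.

Arguments sect : simpl never.

Lemma mulallK n (R : n.-tuple nat) x : homog V R x -> sect R (mulall x) = x.
Proof.
elim: n R x => [|n IHn] R x.
  (* For n = 0, M sends c to c times the unit, and sect reads off degree 0. *)
  rewrite [sect _ _]/((x : k) * (talg_one V 0 : k)) dsum_inj_in => _.
  exact: mulr1.
apply: (homog_ind (A := [set x | sect R (mulall x) = x])) => [|w {}x pw Rx].
  apply: (submodule_eq (g := id)) => //.
  exact: linear_comp (@sect_linear _ R) (@mulall_linear n.+1).
rewrite /= mulall_cons sect_mul ?IHn //.
exact: mulall_homog.
Qed.

Lemma sectK n (R : n.-tuple nat) w : piece (sumn R) w -> mulall (sect R w) = w.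
Proof.
elim: n R w => [|n IHn] R w.
  rewrite tuple0 /sect /mulall => -[c _ <-].
  rewrite dsum_inj_in -(linear_scale _ _ (dsum_inj_linear (V := V) 0)).
  by congr (ι 0 _); apply: mulr1.
rewrite sumn_tuple.
apply: (piece_ind (A := [set w | mulall (sect R w) = w])) => [|u v pu pv].
  apply: (submodule_eq (g := id)) => //.
  exact: linear_comp (@mulall_linear n.+1) (@sect_linear _ R).
by rewrite /= sect_mul // mulall_cons IHn.
Qed.

Lemma mulall_inj n (R : n.-tuple nat) x y :
  homog V R x -> homog V R y -> mulall x = mulall y -> x = y.
Proof. by move=> Rx Ry xy; rewrite -[x](mulallK Rx) xy mulallK. Qed.

(** The universal property of the direct sum W = ⊕ V^{⊗r}.  The bound on the
    support of w is only known to exist; by [dliftE] the value does not depend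
    on the bound that is picked. *)
Section DirectSumLift.
Variable P : lmodType k.

Definition dlift (g : forall r, tpow V r -> P) (w : W) : P :=
  \sum_(r < sval (cid (dsum_fin w))) g r (w r).

Lemma dliftE g (w : W) N : (forall r, linear (g r)) ->
  (forall r, (N <= r)%N -> w r = 0) -> dlift g w = \sum_(r < N) g r (w r).
Proof.
move=> gl wN; rewrite /dlift; case: cid => N' wN' /=.
have widen n m : (n <= m)%N -> (forall r, (n <= r)%N -> w r = 0) ->
    \sum_(r < n) g r (w r) = \sum_(r < m) g r (w r).
  move=> nm wn; rewrite -!(big_mkord xpredT (fun r => g r (w r))).
  rewrite [RHS](@big_cat_nat _ _ _ n) //= [X in _ = _ + X]big1_seq ?addr0 // => r.
  rewrite mem_index_iota => /andP[_ /andP[/wn -> _]].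
  exact: linear0_eq.
by rewrite (widen _ (maxn N N')) ?leq_maxr // [RHS](widen _ (maxn N N')) ?leq_maxl.
Qed.

Lemma dlift_linear g : (forall r, linear (g r)) -> linear (dlift g).
Proof.
move=> gl a u v; have [N uN] := dsum_fin u; have [N' vN'] := dsum_fin v.
have uM r : (maxn N N' <= r)%N -> u r = 0 by rewrite geq_max => /andP[/uN].
have vM r : (maxn N N' <= r)%N -> v r = 0 by rewrite geq_max => /andP[_ /vN'].
rewrite !(@dliftE _ _ (maxn N N')) //; last first.
  by move=> r Mr /=; rewrite uM // vM // scaler0 addr0.
rewrite scaler_sumr -big_split; apply: eq_bigr => r _ /=; exact: gl.
Qed.

Lemma dlift_inj g r (a : tpow V r) : (forall r, linear (g r)) ->
  dlift g (ι r a) = g r a.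
Proof.
move=> gl; rewrite (@dliftE _ _ r.+1) //; last first.
  by move=> s rs; rewrite dsum_inj_out // gtn_eqF.
rewrite big_ord_recr /= dsum_inj_in big1 ?add0r // => s _.
by rewrite dsum_inj_out ?linear0_eq // ltn_eqF.
Qed.

End DirectSumLift.

(** The universal property of W^{⊗n} = ⊕_R V^{⊗R}: a family of linear maps, one
    for each multidegree, glues to a linear map on W^{⊗n}. *)
Fixpoint homog_lift (P : lmodType k) n :
    (n.-tuple nat -> tpow W n -> P) -> tpow W n -> P :=
  match n with
  | 0 => fun φ => φ [tuple]
  | n'.+1 => fun φ => tlift (fun w x =>
      dlift (fun r a =>
        @homog_lift P n' (fun R y => φ [tuple of r :: R] (ι r a ⊗ y)) x) w)
  end.

(** The inner lift is linear in w only because linear maps on W^{⊗n} that agree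
    on every V^{⊗R} are equal; this is what makes the recursion bilinear. *)
Lemma homog_liftP (P : lmodType k) n (φ : n.-tuple nat -> tpow W n -> P) :
  (forall R, linear (φ R)) ->
  linear (homog_lift φ) /\ forall R x, homog V R x -> homog_lift φ x = φ R x.
Proof.
elim: n φ => [|n IHn] φ φl.
  by split=> [|R x _] /=; [exact: φl|rewrite (tuple0 R)].
pose ψ r (a : tpow V r) (R : n.-tuple nat) (y : tpow W n) :=
  φ [tuple of r :: R] (ι r a ⊗ y).
have ψl r a R : linear (@ψ r a R).
  exact: (linear_comp (φl _) ((tens_bilinear _ _).2 _)).
have gl r a := (IHn _ (ψl r a)).1; have gE r a := (IHn _ (ψl r a)).2.
have gaE r y : linear (fun a => homog_lift (@ψ r a) y).
  move=> b c c'; move: y.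
  apply: (homog_ext (gl _ _) (linear_comb b (gl _ _) (gl _ _))) => R x Rx.
  rewrite !(gE _ _ R x Rx) /ψ dsum_inj_linear (tens_bilinear _ _).1; exact: φl.
have bil : bilinear_for *:%R *:%R
    (fun w x => dlift (fun r a => homog_lift (@ψ r a) x) w).
  have dl x := dlift_linear (gaE^~ x).
  split=> [x|w a x x'] /=; first exact: dl.
  move: w; apply: talg_ext (dl _) (linear_comb a (dl x) (dl x')) _ => r c.
  by rewrite !(dlift_inj _ (gaE^~ _)) gl.
split=> [|R]; first exact: tlift_linear bil.
apply: homog_ind => [|_ x [a _ <-] Rx].
  exact: submodule_eq (tlift_linear bil) (φl _).
rewrite /= tliftE // (dlift_inj _ (gaE^~ _)) (gE _ _ _ _ Rx) /ψ.
by congr (φ _ _); apply: val_inj; case/tupleP: R a Rx.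
Qed.

End TensorPowers.

Arguments homog_submodule {k V n} R.
Arguments sect_linear {k V n} R.

(** * Extending an endomorphism by the identity on both sides *)
Section Sandwich.
Variables (k : fieldType) (V : lmodType k).

Local Notation W := (talg V).
Local Infix "⋆" := (@talg_mul k V) (at level 40, left associativity).
Implicit Types f g : W -> W.

Let mull_bilinear f : linear f ->
  bilinear_for *:%R *:%R (fun w v => f w ⋆ v).
Proof.
move=> fl; split=> [v a w w'|w] /=; last exact: talg_mulr_linear.
by rewrite fl talg_mull_linear.
Qed.

Let mulr_bilinear f : linear f ->
  bilinear_for *:%R *:%R (fun w v => w ⋆ f v).
Proof.
move=> fl; split=> [v|w a v v'] /=; first exact: talg_mull_linear.
by rewrite fl talg_mulr_linear.
Qed.

(** id ⊗ f ⊗ id on W_p ⊗ W_s ⊗ W_q = W_{p+s+q}, seen inside W. *)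
Definition sandwich p s q f : W -> W :=
  mul_lift p (s + q) (fun u w => u ⋆ mul_lift s q (fun w v => f w ⋆ v) w).

Section Linear.
Variables (p s q : nat) (f : W -> W).
Hypothesis fl : linear f.

Let inner_linear : linear (mul_lift s q (fun w v => f w ⋆ v)).
Proof. exact: mul_lift_linear (mull_bilinear fl). Qed.

Lemma sandwich_linear : linear (sandwich p s q f).
Proof. exact: mul_lift_linear (mulr_bilinear inner_linear). Qed.

Lemma sandwichE u w v : piece p u -> piece s w -> piece q v ->
  sandwich p s q f (u ⋆ (w ⋆ v)) = u ⋆ (f w ⋆ v).
Proof.
move=> pu pw pv; rewrite /sandwich (mul_liftE (mulr_bilinear inner_linear)) //.
  by rewrite /= (mul_liftE (mull_bilinear fl)).
exact: piece_mul.
Qed.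

Lemma sandwich_piece : (forall w, piece s w -> piece s (f w)) ->
  forall w, piece (p + (s + q)) (sandwich p s q f w).
Proof.
move=> fs w; apply: (mul_lift_ind (A := piece _) (mulr_bilinear inner_linear)).
  exact: piece_submodule.
move=> u v pu _ /=; apply: piece_mul => //.
apply: (mul_lift_ind (A := piece _) (mull_bilinear fl)).
  exact: piece_submodule.
by move=> w' v' pw' pv'; apply: piece_mul => //; apply: fs.
Qed.

End Linear.

Lemma piece_ext3 p s q (P : lmodType k) (f g : W -> P) : linear f -> linear g ->
  (forall u w v, piece p u -> piece s w -> piece q v ->
     f (u ⋆ (w ⋆ v)) = g (u ⋆ (w ⋆ v))) ->
  forall w, piece (p + (s + q)) w -> f w = g w.
Proof.
move=> fl gl fg; apply: (piece_ind (submodule_eq fl gl)) => u x pu px.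
have ul (h : W -> P) : linear h -> linear (h \o talg_mul u).
  by move=> hl; apply: linear_comp hl (talg_mulr_linear u).
move: x px; apply: (piece_ind (submodule_eq (ul _ fl) (ul _ gl))) => w v pw pv.
exact: fg.
Qed.

End Sandwich.

(** * Graded automorphisms as families of maps on the tensor algebra *)
Section Components.
Variables (k : fieldType) (V : lmodType k).

Local Notation W := (talg V).

Section Fixed.
Variable n : nat.
Implicit Types (psi phi : cgroup V n) (R : n.-tuple nat).

Lemma cgroup_linear psi : linear psi.
Proof. by have [] := cgroupP psi. Qed.

Lemma cgroup_homog psi R x : homog V R x -> homog V R (psi x).
Proof. by move=> Rx; have [_ _ <-] := cgroupP psi; exists x. Qed.

(** The restriction of psi to V^{⊗R}, transported along M : V^{⊗R} = W_|R|. *)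
Definition component psi R : W -> W := @mulall k V n \o psi \o sect R.

Lemma component_linear psi R : linear (component psi R).
Proof.
apply: linear_comp (sect_linear R).
exact: linear_comp (@mulall_linear _ _ n) (cgroup_linear psi).
Qed.

Lemma component_piece psi R w : piece (sumn R) (component psi R w).
Proof. by apply/mulall_homog/cgroup_homog/sect_homog. Qed.

Lemma component_mulall psi R x :
  homog V R x -> component psi R (mulall x) = mulall (psi x).
Proof. by move=> Rx; rewrite /component /= mulallK. Qed.

Lemma component1 R w : piece (sumn R) w -> component (1%g : cgroup V n) R w = w.
Proof. exact: sectK. Qed.

Lemma componentM psi phi R w :
  component (psi * phi)%g R w = component psi R (component phi R w).
Proof.
rewrite [component phi _ _]/= component_mulall //.
exact/cgroup_homog/sect_homog.
Qed.

(** M is not injective on W^{⊗n}, but it is on each V^{⊗R}, and these are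
    preserved by psi and phi. *)
Lemma cgroup_eq_mulall psi phi :
  (forall R x, homog V R x -> mulall (psi x) = mulall (phi x)) -> psi = phi.
Proof.
move=> e; apply: cgroup_ext.
apply: (homog_ext (cgroup_linear psi) (cgroup_linear phi)) => R x Rx.
by apply: (@mulall_inj _ _ _ R); [apply: cgroup_homog|apply: cgroup_homog|exact: e Rx].
Qed.

Lemma component_inj psi phi :
  (forall R w, piece (sumn R) w -> component psi R w = component phi R w) ->
  psi = phi.
Proof.
move=> e; apply: cgroup_eq_mulall => R x Rx.
by rewrite -!(component_mulall _ Rx) e //; apply: mulall_homog.
Qed.

Definition degreewise (l : n.-tuple nat -> W -> W) := forall R,
  linear (l R) /\ forall w, piece (sumn R) w -> piece (sumn R) (l R w).

Definition assemble (l : n.-tuple nat -> W -> W) : tpow W n -> tpow W n :=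
  homog_lift (fun R x => sect R (l R (mulall x))).

Let sect_degreewise_linear l R : degreewise l ->
  linear (fun x : tpow W n => sect R (l R (mulall x))).
Proof.
move=> dl; apply: (linear_comp (sect_linear R)).
exact: linear_comp (dl R).1 (@mulall_linear _ _ n).
Qed.

Lemma assemble_linear l : degreewise l -> linear (assemble l).
Proof.
by move=> dl; have [] := homog_liftP (fun R => sect_degreewise_linear R dl).
Qed.

Lemma assembleE l R x : degreewise l -> homog V R x ->
  assemble l x = sect R (l R (mulall x)).
Proof.
by move=> dl; have [_] := homog_liftP (fun R => sect_degreewise_linear R dl); apply.
Qed.

Lemma assembleK l l' : degreewise l -> degreewise l' ->
  (forall R w, piece (sumn R) w -> l' R (l R w) = w) ->
  cancel (assemble l) (assemble l').
Proof.
move=> dl dl' ll'; apply: (homog_ext (g := id)) => // [|R x Rx].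
  exact: linear_comp (assemble_linear dl') (assemble_linear dl).
rewrite (assembleE dl Rx) (assembleE dl' (sect_homog _ _)).
have pw := mulall_homog Rx.
by rewrite sectK ?ll' ?mulallK //; apply: (dl R).2.
Qed.

Lemma assemble_graded_auto l l' : degreewise l -> degreewise l' ->
  (forall R w, piece (sumn R) w -> l' R (l R w) = w) ->
  (forall R w, piece (sumn R) w -> l R (l' R w) = w) ->
  @graded_auto k V n (assemble l).
Proof.
move=> dl dl' ll' l'l; split; first exact: assemble_linear.
  by exists (assemble l'); apply: assembleK.
move=> R; apply/seteqP; split=> [_ [x Rx <-]|x Rx].
  by rewrite (assembleE dl Rx); apply: sect_homog.
exists (assemble l' x); last exact: (assembleK dl' dl l'l).
by rewrite (assembleE dl' Rx); apply: sect_homog.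
Qed.

(** With [component_inj]: C^n[V] is the product over R of the groups GL(W_|R|). *)
Lemma component_assemble l l' : degreewise l -> degreewise l' ->
  (forall R w, piece (sumn R) w -> l' R (l R w) = w) ->
  (forall R w, piece (sumn R) w -> l R (l' R w) = w) ->
  exists psi, forall R w, piece (sumn R) w -> component psi R w = l R w.
Proof.
move=> dl dl' ll' l'l.
exists (cgroup_mk (assemble_graded_auto dl dl' ll' l'l)) => R w pw.
rewrite /component /= [cgroup_fun _ _](assembleE dl (sect_homog R w)).
by rewrite !sectK //; apply: (dl R).2.
Qed.

End Fixed.
End Components.

(** * Cutting multidegrees along monotone maps *)
Section Pullback.
Implicit Types (m n : nat).

Definition block n (R : n.-tuple nat) a b : nat := \sum_(a <= i < b) nth 0 R i.

Lemma block_cat n (R : n.-tuple nat) a b c : (a <= b)%N -> (b <= c)%N ->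
  block R a c = (block R a b + block R b c)%N.
Proof. by move=> ab bc; rewrite /block (@big_cat_nat _ _ _ b). Qed.

Lemma block0 n (R : n.-tuple nat) a : block R a a = 0.
Proof. exact: big_geq. Qed.

Lemma block1 n (R : n.-tuple nat) a : block R a a.+1 = nth 0 R a.
Proof. exact: big_nat1. Qed.

Lemma sumn_block n (R : n.-tuple nat) : sumn R = block R 0 n.
Proof. by rewrite sumnE (big_nth 0) size_tuple. Qed.

Section Monotone.
Variables (m n : nat) (f : {omorphism 'I_m.+1 -> 'I_n.+1}).
Implicit Type R : n.-tuple nat.

(** The monotone map f on vertices, extended to all natural numbers so that
    sums over intervals can be cut without bounds; only j <= m is meaningful. *)
Definition vertex j : nat := f (inord j).

Lemma vertex_le i j : (i <= j <= m)%N -> (vertex i <= vertex j)%N.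
Proof.
move=> /andP[ij jm]; have := @omorph_le _ _ _ _ f (inord i) (inord j).
by rewrite !leEord /= !inordK ?ltnS ?(leq_trans ij) //; apply.
Qed.

Lemma vertex_bound j : (vertex j <= n)%N.
Proof. by rewrite -ltnS; apply: ltn_ord. Qed.

(** The sums of the blocks into which f cuts R.  Entry number l of R, counted
    from 0, joins the vertices l and l.+1 of {0..n}, so block j consists of the
    entries between f j and f j.+1. *)
Definition pullback R : m.-tuple nat :=
  [tuple block R (vertex j) (vertex j.+1) | j < m].

Lemma nth_pullback R j : (j < m)%N ->
  nth 0 (pullback R) j = block R (vertex j) (vertex j.+1).
Proof. by move=> jm; rewrite -[j]/(val (Ordinal jm)) -tnth_nth tnth_mktuple. Qed.

Lemma block_pullback R a b : (a <= b <= m)%N ->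
  block (pullback R) a b = block R (vertex a) (vertex b).
Proof.
move=> /andP[ab bm]; elim: b ab bm => [|b IHb].
  by rewrite leqn0 => /eqP-> _; rewrite !block0.
rewrite leq_eqVlt => /predU1P[-> _|]; first by rewrite !block0.
rewrite ltnS => ab bm; rewrite (@block_cat _ _ _ b) // IHb ?(ltnW bm) //.
rewrite block1 nth_pullback // -block_cat //; apply: vertex_le.
  by rewrite ab ltnW.
by rewrite leqnSn.
Qed.

Definition prefix_degree R := block R 0 (vertex 0).
Definition suffix_degree R := block R (vertex m) n.

Lemma sumn_pullback R :
  sumn R = (prefix_degree R + (sumn (pullback R) + suffix_degree R))%N.
Proof.
rewrite !sumn_block block_pullback ?leqnn //.
rewrite -block_cat ?vertex_le ?leqnn ?vertex_bound // -block_cat //.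
exact: vertex_bound.
Qed.

End Monotone.

Section Composition.
Variables (l m n : nat).
Variables (f : {omorphism 'I_l.+1 -> 'I_m.+1}).
Variables (g : {omorphism 'I_m.+1 -> 'I_n.+1}).
Implicit Type R : n.-tuple nat.

Lemma vertex_comp j : vertex (g \o f) j = vertex g (vertex f j).
Proof. by rewrite /vertex /= inord_val. Qed.

Lemma pullback_comp R : pullback (g \o f) R = pullback f (pullback g R).
Proof.
apply: eq_from_tnth => j; rewrite !tnth_mktuple !vertex_comp block_pullback //.
by rewrite vertex_bound vertex_le // leqnSn ltn_ord.
Qed.

Lemma prefix_degree_comp R :
  prefix_degree (g \o f) R = (prefix_degree g R + prefix_degree f (pullback g R))%N.
Proof.
rewrite /prefix_degree vertex_comp block_pullback ?leq0n ?vertex_bound //.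
by rewrite -block_cat // vertex_le // vertex_bound.
Qed.

Lemma suffix_degree_comp R :
  suffix_degree (g \o f) R = (suffix_degree f (pullback g R) + suffix_degree g R)%N.
Proof.
rewrite /suffix_degree vertex_comp block_pullback ?leqnn ?vertex_bound //.
by rewrite -block_cat ?vertex_bound // vertex_le // vertex_bound leqnn.
Qed.

End Composition.

Lemma vertex_id n j : (j <= n)%N -> vertex (idfun : 'I_n.+1 -> 'I_n.+1) j = j.
Proof. by move=> jn; rewrite /vertex /= inordK. Qed.

Lemma pullback_id n (R : n.-tuple nat) :
  pullback (idfun : 'I_n.+1 -> 'I_n.+1) R = R.
Proof.
apply: eq_from_tnth => j; rewrite tnth_mktuple !vertex_id ?(ltnW (ltn_ord j)) //.
by rewrite block1 -tnth_nth.
Qed.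

End Pullback.

(** * The functor *)
Section Pushforward.
Variables (k : fieldType) (V : lmodType k).

Local Notation W := (talg V).
Local Infix "⋆" := (@talg_mul k V) (at level 40, left associativity).

Section Fixed.
Variables (m n : nat) (f : {omorphism 'I_m.+1 -> 'I_n.+1}).
Implicit Types (psi phi : cgroup V m) (chi : cgroup V n) (R : n.-tuple nat).

(** chi acts on multidegree R as id ⊗ psi ⊗ id, with psi acting on the blocks
    into which f cuts R and the identities on the prefix and the suffix. *)
Definition is_pushforward psi chi := forall R u w v,
  piece (prefix_degree f R) u -> piece (sumn (pullback f R)) w ->
  piece (suffix_degree f R) v ->
  component chi R (u ⋆ (w ⋆ v)) = u ⋆ (component psi (pullback f R) w ⋆ v).

Lemma pushforward_ext (P : lmodType k) (g h : W -> P) R : linear g -> linear h ->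
  (forall u w v, piece (prefix_degree f R) u -> piece (sumn (pullback f R)) w ->
     piece (suffix_degree f R) v -> g (u ⋆ (w ⋆ v)) = h (u ⋆ (w ⋆ v))) ->
  forall w, piece (sumn R) w -> g w = h w.
Proof. by move=> gl hl gh; rewrite (sumn_pullback f); apply: piece_ext3. Qed.

Lemma is_pushforward_unique psi chi chi' :
  is_pushforward psi chi -> is_pushforward psi chi' -> chi = chi'.
Proof.
move=> pc pc'; apply: component_inj => R.
apply: pushforward_ext => [||u w v pu pw pv]; try exact: component_linear.
by rewrite pc // pc'.
Qed.

Let pushed psi R :=
  sandwich (prefix_degree f R) (sumn (pullback f R)) (suffix_degree f R)
    (component psi (pullback f R)).

Let pushed_degreewise psi : degreewise (pushed psi).
Proof.
move=> R; split=> [|w _]; first exact: sandwich_linear (component_linear _ _).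
rewrite (sumn_pullback f); apply: sandwich_piece (component_linear _ _) _ w.
by move=> w _; apply: component_piece.
Qed.

(** Sandwiching is multiplicative, so the sandwiches of psi and of its inverse
    are mutually inverse and assemble to a graded automorphism. *)
Let pushedK psi phi R w : (psi * phi = 1)%g -> piece (sumn R) w ->
  pushed psi R (pushed phi R w) = w.
Proof.
move=> e; have sl c := sandwich_linear (prefix_degree f R) (sumn (pullback f R))
  (suffix_degree f R) (component_linear (c : cgroup V m) (pullback f R)).
move: w; apply: (pushforward_ext (linear_comp (sl psi) (sl phi)) (h := id)) => //.
move=> u w v pu pw pv.
rewrite [LHS]/comp !sandwichE //; try exact: component_linear; last first.
  exact: component_piece.
by rewrite -componentM e component1.
Qed.

Lemma pushforward_exists psi : exists chi, is_pushforward psi chi.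
Proof.
have [||chi chiE] := component_assemble (pushed_degreewise psi)
    (pushed_degreewise psi^-1%g).
- by move=> R w; apply: pushedK; apply: mulVg.
- by move=> R w; apply: pushedK; apply: mulgV.
exists chi => R u w v pu pw pv; rewrite chiE.
  by rewrite /pushed sandwichE //; apply: component_linear.
by rewrite (sumn_pullback f); do 2?apply: piece_mul.
Qed.

Definition pushforward psi : cgroup V n := sval (cid (pushforward_exists psi)).

Lemma pushforwardP psi : is_pushforward psi (pushforward psi).
Proof. exact: svalP (cid (pushforward_exists psi)). Qed.

Lemma pushforwardM : {morph pushforward : psi phi / (psi * phi)%g}.
Proof.
move=> psi phi; apply: is_pushforward_unique (pushforwardP _) _.
move=> R u w v pu pw pv; rewrite !componentM !pushforwardP //.
exact: component_piece.
Qed.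

HB.instance Definition _ :=
  isMultiplicative.Build (cgroup V m) (cgroup V n) pushforward pushforwardM.

End Fixed.

Lemma pushforward_id n (psi : cgroup V n) : pushforward idfun psi = psi.
Proof.
apply: is_pushforward_unique; first exact: pushforwardP.
move=> R u w v.
rewrite /prefix_degree /suffix_degree !vertex_id // pullback_id !block0.
(* Nothing is cut off, so u and v are scalars. *)
move=> /piece0P[a ->] _ /piece0P[b ->].
have cl := component_linear psi R.
by rewrite !talg_scalel !talg_scaler !talg_1mul !talg_mul1 !(linear_scale _ _ cl).
Qed.

(** Writing u, w, v for the cut along g and u', w', v' for the cut of the block
    sums along f, both sides send u (u' w' v') v to u u' psi(w') v' v. *)
Lemma pushforward_comp l m n (f : {omorphism 'I_l.+1 -> 'I_m.+1})
    (g : {omorphism 'I_m.+1 -> 'I_n.+1}) (psi : cgroup V l) :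
  pushforward (g \o f) psi = pushforward g (pushforward f psi).
Proof.
apply: component_inj => R.
apply: (@pushforward_ext _ _ g) => [||u w v pu]; try exact: component_linear.
move=> pw pv; rewrite [RHS]pushforwardP //.
have inner (h : W -> W) : linear h -> linear (fun w => u ⋆ (h w ⋆ v)).
  move=> hl; apply: (linear_comp (talg_mulr_linear u)).
  exact: linear_comp (talg_mull_linear v) hl.
move: w pw; apply: (@pushforward_ext _ _ f) => [||u' w v' pu' pw pv'].
- exact: linear_comp (component_linear _ _) (inner id _).
- exact: inner (component_linear _ _).
rewrite [in RHS]pushforwardP // -!(talg_mulA _ _ v) !(talg_mulA u).
rewrite pushforwardP ?pullback_comp ?prefix_degree_comp ?suffix_degree_comp //.
- exact: piece_mul.
- exact: piece_mul.
Qed.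

Definition cosimplicial_cgroup : cosimplicial (fun n => cgroup V n) :=
  @Cosimplicial (fun n => cgroup V n)
    (fun m n f => (@pushforward m n f : {multiplicative _ -> _}))
    pushforward_id pushforward_comp.
End Pushforward.

(** * Cofaces and codegeneracies *)
Section StructureMaps.
Variables (k : fieldType) (V : lmodType k).

Local Notation W := (talg V).
Local Infix "⋆" := (@talg_mul k V) (at level 40, left associativity).

Lemma mulall_mul_first n (x : tpow W n.+2) : mulall (mul_first x) = mulall x.
Proof.
have ml := linear_comp (@mulall_linear k V n.+1) (@mul_first_linear k V n).
have mr := @mulall_linear k V n.+2.
move: x; apply: (tens_ext ml mr) => u x.
have ul : linear (fun y : tpow W n.+1 => u ⊗ y) by exact: (tens_bilinear _ _).2.
have mul : linear (fun y : tpow W n.+1 => mulall (mul_first (u ⊗ y))).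
  exact: (linear_comp ml ul).
have mur : linear (fun y : tpow W n.+1 => @mulall k V n.+2 (u ⊗ y)).
  exact: (linear_comp mr ul).
move: x; apply: (tens_ext mul mur) => v x.
by rewrite mul_firstE !mulall_cons talg_mulA.
Qed.

Lemma mul_at0 n (x : tpow W n.+2) : mul_at V ord0 x = mul_first x.
Proof. by case: n x => // n x; rewrite /= unlift_none. Qed.

Lemma mul_at_lift n (j : 'I_n.+1) u (x : tpow W n.+2) :
  @mul_at k V n.+1 (lift ord0 j) (u ⊗ x) = u ⊗ mul_at V j x.
Proof. by rewrite /= liftK tmapE //; apply: mul_at_linear. Qed.

Lemma unit_at0 n (x : tpow W n) : unit_at V ord0 x = talg_one V ⊗ x.
Proof. by case: n x => // n x; rewrite /= unlift_none. Qed.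

Lemma unit_at_lift n (i : 'I_n.+1) u (x : tpow W n) :
  @unit_at k V n.+1 (lift ord0 i) (u ⊗ x) = u ⊗ unit_at V i x.
Proof. by rewrite /= liftK tmapE //; apply: unit_at_linear. Qed.

Lemma mulall_mul_at n (j : 'I_n.+1) (x : tpow W n.+2) :
  mulall (mul_at V j x) = mulall x.
Proof.
elim: n j x => [|n IHn] j x; first by rewrite (ord1 j) mul_at0 mulall_mul_first.
case: (unliftP ord0 j) => [j' ->|->]; last by rewrite mul_at0 mulall_mul_first.
have ml := linear_comp (@mulall_linear k V n.+2)
  (mul_at_linear (V := V) (lift ord0 j')).
move: x; apply: (tens_ext ml (@mulall_linear k V n.+3)) => u x.
by rewrite [LHS]/comp mul_at_lift !mulall_cons IHn.
Qed.

Lemma mulall_unit_at n (i : 'I_n.+1) (x : tpow W n) :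
  mulall (unit_at V i x) = mulall x.
Proof.
elim: n i x => [|n IHn] i x; first by rewrite mulall_cons talg_mul1.
case: (unliftP ord0 i) => [i' ->|->]; last first.
  by rewrite unit_at0 mulall_cons talg_mul1.
have ml := linear_comp (@mulall_linear k V n.+2)
  (unit_at_linear (V := V) (lift ord0 i')).
move: x; apply: (tens_ext ml (@mulall_linear k V n.+1)) => u x.
by rewrite [LHS]/comp unit_at_lift !mulall_cons IHn.
Qed.

Lemma tsnoc_cons n u (x : tpow W n) w : @tsnoc k V n.+1 (u ⊗ x) w = u ⊗ tsnoc x w.
Proof. by rewrite /= tmapE //; apply: tsnoc_linear. Qed.

Lemma mulall_tsnoc n (x : tpow W n) w : mulall (tsnoc x w) = mulall x ⋆ w.
Proof.
elim: n x => [|n IHn] x.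
  by rewrite mulall_cons !mulall0 talg_scalel talg_scaler talg_1mul talg_mul1.
have sl := linear_comp (@mulall_linear k V n.+2) (@tsnoc_linear k V n.+1 w).
have ml := linear_comp (talg_mull_linear w) (@mulall_linear k V n.+1).
move: x; apply: (tens_ext sl ml) => u x.
rewrite [LHS]/comp tsnoc_cons mulall_cons IHn.
by rewrite [RHS]/comp mulall_cons talg_mulA.
Qed.

Lemma tsnoc_ind n (A : set (tpow W n.+1)) : submodule A ->
  (forall x w, A (tsnoc x w)) -> forall y, A y.
Proof.
elim: n A => [|n IHn] A sA Axw; apply: tens_ind => // u.
  by move=> c; apply: (Axw c u).
apply: (IHn (tens u @^-1` A)).
  exact: submodule_preimage ((tens_bilinear _ _).2 u) sA.
by move=> x w; rewrite /preimage /= -tsnoc_cons; apply: Axw.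
Qed.

Lemma tsnoc_homog n (R : n.-tuple nat) (T : n.+1.-tuple nat) r x w :
  tval T = rcons R r -> homog V R x -> piece r w -> homog V T (tsnoc x w).
Proof.
move=> + + pw; elim: n R T x => [|n IHn] R T x.
  case/tupleP: T => t T; rewrite (tuple0 R) (tuple0 T) => -[->] _.
  by apply: homog_cons; rewrite ?theadE // behead_cons_tuple.
case/tupleP: T => t T; case/tupleP: R => r' R /= [-> TR].
apply: (homog_ind (A := (fun y => @tsnoc k V n.+1 y w) @^-1` homog V _)).
  exact: submodule_preimage (@tsnoc_linear k V n.+1 w) (homog_submodule _).
move=> u {}x pu Rx; rewrite /preimage /mkset tsnoc_cons.
apply: homog_cons; first by rewrite theadE; rewrite theadE in pu.
by rewrite behead_cons_tuple; rewrite behead_cons_tuple in Rx; apply: IHn Rx.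
Qed.

(** The hypothesis on T says that T is R with the entries j and j+1 added; it is
    given entrywise because T will be a pullback of R. *)
Lemma mul_at_homog n (j : 'I_n.+1) (R : n.+2.-tuple nat) (T : n.+1.-tuple nat) x :
  (forall l, (l <= n)%N -> nth 0 T l =
     if (l < j)%N then nth 0 R l
     else if l == j then (nth 0 R j + nth 0 R j.+1)%N else nth 0 R l.+1) ->
  homog V R x -> homog V T (mul_at V j x).
Proof.
have first n' (R' : n'.+2.-tuple nat) (T' : n'.+1.-tuple nat) y :
    (forall l, (l <= n')%N -> nth 0 T' l =
       if l == 0 then (nth 0 R' 0 + nth 0 R' 1)%N else nth 0 R' l.+1) ->
    homog V R' y -> homog V T' (mul_first y).
  move: y; case/tupleP: R' => r R'; case/tupleP: R' => s R'.
  case/tupleP: T' => t T' y TE.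
  have -> : t = (r + s)%N by have := TE 0 isT.
  have -> : T' = R'.
    apply: eq_from_tnth => l; rewrite !(tnth_nth 0).
    by have := TE l.+1 (ltn_ord l).
  have ml := @mul_first_linear k V n'.
  apply: (homog_ind (A := @mul_first k V n' @^-1` homog V _)) => [|u x' pu].
    exact: submodule_preimage ml (homog_submodule _).
  apply: (homog_ind (A := tens u @^-1` (@mul_first k V n' @^-1` homog V _))).
    apply: submodule_preimage ((tens_bilinear _ _).2 u) _.
    exact: submodule_preimage ml (homog_submodule _).
  move=> v x'' pv Rx; rewrite /preimage /mkset mul_firstE; apply: homog_cons.
    by rewrite theadE; apply: piece_mul.
  by rewrite behead_cons_tuple; move: Rx; rewrite !behead_cons_tuple.
elim: n j R T x => [|n IHn] j R T x TE.
  by rewrite (ord1 j) mul_at0 in TE *; apply: first.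
move=> Rx; case: (unliftP ord0 j) TE => [j' ->|->] TE; last first.
  by rewrite mul_at0; apply: first Rx => l ln; rewrite TE.
move: x Rx TE; case/tupleP: R => r R; case/tupleP: T => t T x Rx TE.
have -> : t = r by have := TE 0 isT.
move: x Rx.
apply: (homog_ind (A := mul_at V (lift ord0 j') @^-1` homog V _)) => [|u x pu Rx].
  exact: submodule_preimage (mul_at_linear _) (homog_submodule _).
rewrite /preimage /mkset mul_at_lift.
apply: homog_cons; first by rewrite theadE in pu *.
rewrite !behead_cons_tuple in Rx *; apply: IHn Rx => l ln.
by have := TE l.+1 ln; rewrite /= /bump /= add1n ltnS eqSS.
Qed.

(** Here T is R with a zero inserted at position i. *)
Lemma unit_at_homog n (i : 'I_n.+1) (R : n.-tuple nat) (T : n.+1.-tuple nat) x :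
  (forall l, (l <= n)%N -> nth 0 T l =
     if (l < i)%N then nth 0 R l
     else if l == i then 0%N else nth 0 R l.-1) ->
  homog V R x -> homog V T (unit_at V i x).
Proof.
have first n' (R' : n'.-tuple nat) (T' : n'.+1.-tuple nat) y :
    (forall l, (l <= n')%N -> nth 0 T' l =
       if l == 0 then 0%N else nth 0 R' l.-1) ->
    homog V R' y -> homog V T' (talg_one V ⊗ y).
  case/tupleP: T' => t T' TE Ry.
  have -> : t = 0 by have := TE 0 isT.
  have -> : T' = R'.
    apply: eq_from_tnth => l; rewrite !(tnth_nth 0).
    by have := TE l.+1 (ltn_ord l).
  by apply: homog_cons; rewrite ?theadE ?behead_cons_tuple //; apply: piece_one.
elim: n i R T x => [|n IHn] i R T x TE.
  by rewrite (ord1 i) unit_at0 in TE *; apply: first.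
move=> Rx; case: (unliftP ord0 i) TE => [i' ->|->] TE; last first.
  by rewrite unit_at0; apply: first Rx => l ln; rewrite TE.
move: x Rx TE; case/tupleP: R => r R; case/tupleP: T => t T x Rx TE.
have -> : t = r by have := TE 0 isT.
move: x Rx.
apply: (homog_ind (A := unit_at V (lift ord0 i') @^-1` homog V _)) => [|u x pu Rx].
  exact: submodule_preimage (unit_at_linear _) (homog_submodule _).
rewrite /preimage /mkset unit_at_lift.
apply: homog_cons; first by rewrite theadE in pu *.
rewrite !behead_cons_tuple in Rx *; apply: IHn Rx => l ln.
have := TE l.+1 ln; rewrite /= /bump /= add1n ltnS eqSS => ->.
by case: l {ln} => //=; case: (nat_of_ord i').
Qed.

(** When f preserves the end points nothing is cut off: take u = v = 1. *)
Lemma component_inner m n (f : {omorphism 'I_m.+1 -> 'I_n.+1}) (psi : cgroup V m)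
    (R : n.-tuple nat) w :
  vertex f 0 = 0 -> vertex f m = n -> piece (sumn R) w ->
  component (pushforward f psi) R w = component psi (pullback f R) w.
Proof.
move=> f0 fm pw; have p0 : prefix_degree f R = 0 by rewrite /prefix_degree f0 block0.
have s0 : suffix_degree f R = 0 by rewrite /suffix_degree fm block0.
have := @pushforwardP k V m n f psi R (talg_one V) w (talg_one V).
rewrite p0 s0 !talg_1mul !talg_mul1; apply; try exact: piece_one.
by move: pw; rewrite (sumn_pullback f) p0 s0 addn0.
Qed.

(** Both sides lie in the same V^{⊗S}, where M is injective, and M sends them to
    the same element because h preserves M. *)
Lemma pushforward_intertwine m n (f : {omorphism 'I_m.+1 -> 'I_n.+1})
    (h : tpow W n -> tpow W m) (psi : cgroup V m) :
  vertex f 0 = 0 -> vertex f m = n -> linear h ->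
  (forall x, mulall (h x) = mulall x) ->
  (forall R x, homog V R x -> homog V (pullback f R) (h x)) ->
  forall x, h (pushforward f psi x) = psi (h x).
Proof.
move=> f0 fm hl hM hR; apply: homog_ext => [||R x Rx].
- exact: linear_comp hl (cgroup_linear _).
- exact: linear_comp (cgroup_linear _) hl.
have hRx := hR R x Rx.
apply: (mulall_inj (hR _ _ (cgroup_homog _ Rx)) (cgroup_homog psi hRx)).
rewrite hM -(component_mulall _ Rx) -(component_mulall _ hRx) hM.
by rewrite component_inner //; apply: mulall_homog.
Qed.

(** Applying M to the equation eliminates h: M chi = M psi h = M chi'. *)
Lemma intertwine_unique m n (h : tpow W n -> tpow W m) (psi : cgroup V m)
    (chi chi' : cgroup V n) : (forall x, mulall (h x) = mulall x) ->
  (forall x, h (chi x) = psi (h x)) -> (forall x, h (chi' x) = psi (h x)) ->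
  chi = chi'.
Proof.
move=> hM e e'; apply: cgroup_eq_mulall => R x _.
by rewrite -hM e -e' hM.
Qed.

Lemma vertex_lift n (i : 'I_n.+2) j : (j <= n)%N -> vertex (lift i) j = bump i j.
Proof. by move=> jn; rewrite /vertex /= inordK. Qed.

Lemma vertex_sdeg n (i : 'I_n.+1) j :
  (j <= n.+1)%N -> vertex (sdeg i) j = unbump i j.
Proof.
move=> jn; rewrite /vertex /= /sdeg inordK inordK //.
by have := ltn_ord i; rewrite /unbump; lia.
Qed.

Lemma codegeneracy_pushforward n (i : 'I_n.+1) (psi : cgroup V n.+1) :
  is_codegeneracy i psi (pushforward (sdeg i) psi).
Proof.
have lti := ltn_ord i.
apply: pushforward_intertwine.
- by rewrite vertex_sdeg.
- by rewrite vertex_sdeg // /unbump; lia.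
- exact: unit_at_linear.
- exact: mulall_unit_at.
move=> R x Rx; apply: unit_at_homog Rx => l ln.
rewrite nth_pullback // !vertex_sdeg //; last exact: leqW.
have [li|il|li] := ltngtP l i.
- have -> : unbump i l = l by rewrite /unbump; lia.
  have -> : unbump i l.+1 = l.+1 by rewrite /unbump; lia.
  exact: block1.
- have -> : unbump i l = l.-1 by rewrite /unbump; lia.
  have -> : unbump i l.+1 = l.-1.+1 by rewrite /unbump; lia.
  exact: block1.
- have -> : unbump i l = l by rewrite /unbump; lia.
  have -> : unbump i l.+1 = l by rewrite /unbump; lia.
  exact: block0.
Qed.

Lemma coface_mul_pushforward n (j : 'I_n.+1) (psi : cgroup V n.+1) x :
  forall i : 'I_n.+3, i = j.+1 :> nat ->
  mul_at V j (pushforward (lift i) psi x) = psi (mul_at V j x).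
Proof.
move=> i ij; have ltj := ltn_ord j; move: x.
apply: pushforward_intertwine.
- by rewrite vertex_lift // ij.
- by rewrite vertex_lift // ij /bump; lia.
- exact: mul_at_linear.
- exact: mulall_mul_at.
move=> R x Rx; apply: mul_at_homog Rx => l ln.
rewrite nth_pullback // !vertex_lift //; last exact: leqW.
have [lj|jl|->] := ltngtP l j.
- have -> : bump i l = l by rewrite /bump; lia.
  have -> : bump i l.+1 = l.+1 by rewrite /bump; lia.
  exact: block1.
- have -> : bump i l = l.+1 by rewrite /bump; lia.
  have -> : bump i l.+1 = l.+2 by rewrite /bump; lia.
  exact: block1.
have -> : bump i j = j by rewrite /bump; lia.
have -> : bump i j.+1 = j.+2 by rewrite /bump; lia.
by rewrite (@block_cat _ _ _ j.+1) // !block1.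
Qed.

(** Over C^0 there are no blocks, so the middle factor lies in W_0 = k, where
    chi is multiplication by chi 1. *)
Lemma coface0_pushforward (i : 'I_2) (chi : cgroup V 0) x :
  pushforward (lift i) chi x = (chi (1 : k) : k) *: x.
Proof.
set a : k := chi _.
have sl (M : lmodType k) : linear (fun x : M => a *: x).
  by move=> b y z; rewrite scalerDr !scalerA mulrC.
apply: (homog_ext (cgroup_linear _) (sl _)) => {x}R x Rx.
have Rax := submodule_scale a (homog_submodule R) Rx.
apply: (mulall_inj (cgroup_homog _ Rx) Rax).
rewrite -(component_mulall _ Rx) (linear_scale _ _ (@mulall_linear k V 1)).
move: (mulall x) (mulall_homog Rx) => {Rx Rax} {}x.
apply: (pushforward_ext (f := lift i) (component_linear _ _) (sl _)).
move=> u w v pu + pv; rewrite (tuple0 (pullback _ R)) => pw.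
rewrite pushforwardP // ?(tuple0 (pullback _ R)) //.
have [c ->] := piece0P pw.
rewrite (linear_scale _ _ (component_linear _ _)).
have -> : component chi [tuple] (talg_one V) = a *: talg_one V.
  by rewrite /component /comp sect0 dsum_inj_in mulall0.
by rewrite scalerA mulrC -scalerA !talg_scalel !talg_scaler.
Qed.

(** Along lift ord0 the prefix is the first factor and the suffix is empty. *)
Lemma pushforward_first n (psi : cgroup V n.+1) (chi : cgroup V n.+2) w x :
  is_pushforward (lift (ord0 : 'I_n.+3)) psi chi -> chi (w ⊗ x) = w ⊗ psi x.
Proof.
move=> chiP.
have tl (y : tpow W n.+1) : linear (fun u : W => u ⊗ y).
  exact: (tens_bilinear _ _).1.
have tr (u : W) : linear (fun y : tpow W n.+1 => u ⊗ y).
  exact: (tens_bilinear _ _).2.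
have chil (y : tpow W n.+1) : linear (fun u : W => chi (u ⊗ y)).
  exact: (linear_comp (cgroup_linear chi) (tl y)).
have chir (u : W) : linear (fun y : tpow W n.+1 => chi (u ⊗ y)).
  exact: (linear_comp (cgroup_linear chi) (tr u)).
have psir (u : W) : linear (fun y : tpow W n.+1 => u ⊗ psi y).
  exact: (linear_comp (tr u) (cgroup_linear psi)).
move: w; apply: (talg_ext (chil x) (tl (psi x))) => r a.
move: x; apply: (homog_ext (chir _) (psir _)) => R x Rx.
pose T := [tuple of r :: R].
have Thomog y : homog V R y -> homog V T ((dsum_inj a : W) ⊗ y).
  by move=> Ry; apply: homog_cons; rewrite ?theadE ?behead_cons_tuple //; apply: piece_inj.
have pT : pullback (lift (ord0 : 'I_n.+3)) T = R.
  apply: eq_from_tnth => j; rewrite tnth_mktuple.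
  by rewrite !vertex_lift ?ltn_ord 1?ltnW ?ltn_ord // block1 (tnth_nth 0).
have Tx := Thomog x Rx; have Tpx := Thomog _ (cgroup_homog psi Rx).
rewrite /comp; apply: (mulall_inj (cgroup_homog _ Tx) Tpx).
apply: (eq_trans (esym (component_mulall chi Tx))).
do 2 rewrite -> mulall_cons.
rewrite -[mulall x]talg_1mul chiP ?pT.
- by rewrite component_mulall // talg_1mul.
- by rewrite /prefix_degree vertex_lift // block1; apply: piece_inj.
- exact: mulall_homog.
- by rewrite /suffix_degree vertex_lift // block0; apply: piece_one.
Qed.

Lemma tsnoc_linearr n (x : tpow W n) : linear (tsnoc x).
Proof.
elim: n x => [|n IHn] x; first exact: (tens_bilinear W (tpow W 0)).1.
move=> a w w'; have sl u := @tsnoc_linear k V n.+1 u.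
move: x; apply: (tens_ext (sl _) (linear_comb a (sl w) (sl w'))) => u x.
by rewrite !tsnoc_cons IHn (tens_bilinear _ _).2.
Qed.

(** Along lift ord_max the prefix is empty and the suffix is the last factor. *)
Lemma pushforward_last n (psi : cgroup V n.+1) (chi : cgroup V n.+2) x w :
  is_pushforward (lift (ord_max : 'I_n.+3)) psi chi -> chi (tsnoc x w) = tsnoc (psi x) w.
Proof.
move=> chiP.
have chil (y : tpow W n.+1) : linear (fun u : W => chi (tsnoc y u)).
  exact: (linear_comp (cgroup_linear chi) (tsnoc_linearr y)).
have chir (u : W) : linear (fun y : tpow W n.+1 => chi (tsnoc y u)).
  exact: (linear_comp (cgroup_linear chi) (@tsnoc_linear k V n.+1 u)).
have psir (u : W) : linear (fun y : tpow W n.+1 => tsnoc (psi y) u).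
  exact: (linear_comp (@tsnoc_linear k V n.+1 u) (cgroup_linear psi)).
move: w; apply: (talg_ext (chil x) (tsnoc_linearr (psi x))) => r a.
move: x; apply: (homog_ext (chir _) (psir _)) => R x Rx.
pose T := [tuple of rcons R r].
have Thomog y : homog V R y -> homog V T (tsnoc y (dsum_inj a : W)).
  by move=> Ry; apply: tsnoc_homog Ry _ => //; apply: piece_inj.
have vE j : (j <= n.+1)%N -> vertex (lift (ord_max : 'I_n.+3)) j = j.
  by move=> jn; rewrite vertex_lift // /bump /=; lia.
have pT : pullback (lift (ord_max : 'I_n.+3)) T = R.
  apply: eq_from_tnth => j; rewrite tnth_mktuple.
  rewrite !vE ?ltn_ord 1?ltnW ?ltn_ord // block1 (tnth_nth 0) /=.
  by rewrite nth_rcons size_tuple ltn_ord.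
have Tx := Thomog x Rx; have Tpx := Thomog _ (cgroup_homog psi Rx).
rewrite /comp; apply: (mulall_inj (cgroup_homog _ Tx) Tpx).
apply: (eq_trans (esym (component_mulall chi Tx))).
do 2 rewrite -> mulall_tsnoc.
rewrite -[mulall x ⋆ _]talg_mul1 chiP ?pT.
- by rewrite component_mulall // talg_mul1.
- by rewrite /prefix_degree vE // block0; apply: piece_one.
- exact: mulall_homog.
- rewrite /suffix_degree vE // block1 /= nth_rcons size_tuple ltnn eqxx.
  exact: piece_inj.
Qed.

Lemma coface_pushforward n (i : 'I_n.+2) (psi : cgroup V n) :
  is_coface i psi (pushforward (lift i) psi).
Proof.
case: n i psi => [|n] i psi; first exact: coface0_pushforward.
split=> [->|->|j ij x].
- by move=> w x; apply: pushforward_first; apply: pushforwardP.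
- by move=> x w; apply: pushforward_last; apply: pushforwardP.
- by apply: coface_mul_pushforward.
Qed.

(** The outer coface equations prescribe chi on the spanning elements w ⊗ x or
    x ⊗ w; an inner one determines M chi. *)
Lemma coface_unique n (i : 'I_n.+2) (psi : cgroup V n) (chi chi' : cgroup V n.+1) :
  is_coface i psi chi -> is_coface i psi chi' -> chi = chi'.
Proof.
case: n i psi chi chi' => [|n] i psi chi chi'.
  by move=> /= e e'; apply: cgroup_ext => x; rewrite e e'.
move=> [first last mid] [first' last' mid'].
have [i0|[imax|[j ij]]] : i = ord0 \/ i = ord_max \/
    exists j : 'I_n.+1, i = j.+1 :> nat.
- case: (unliftP ord0 i) => [i' ii'|->]; last by left.
  case: (unliftP ord_max i') => [j i'j|i'max]; last first.
    by right; left; apply: val_inj; rewrite ii' i'max /= /bump.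
  by right; right; exists j; rewrite ii' i'j lift0 lift_max.
- apply: cgroup_ext.
  apply: (tens_ext (cgroup_linear chi) (cgroup_linear chi')) => w x.
  by rewrite first // first'.
- apply: cgroup_ext; apply: (tsnoc_ind (A := [set y | chi y = chi' y])).
    exact: submodule_eq (cgroup_linear _) (cgroup_linear _).
  by move=> x w; rewrite /mkset last // last'.
apply: (intertwine_unique (mulall_mul_at j)) => x; first exact: mid.
exact: mid'.
Qed.

Lemma codegeneracy_unique n (i : 'I_n.+1) (psi : cgroup V n.+1)
    (chi chi' : cgroup V n) :
  is_codegeneracy i psi chi -> is_codegeneracy i psi chi' -> chi = chi'.
Proof. exact: intertwine_unique (mulall_unit_at i). Qed.

End StructureMaps.

Theorem theorem2 (R : realType) (s : scalar_kind)
    (V : lmodType (scalars R s)) :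
  exists F : cosimplicial (fun n : nat => cgroup V n),
    (forall (n : nat) (i : 'I_n.+2) (psi : cgroup V n),
        unique (is_coface i psi) (cs_map F (lift i) psi)) /\
    (forall (n : nat) (i : 'I_n.+1) (psi : cgroup V n.+1),
        unique (is_codegeneracy i psi) (cs_map F (sdeg i) psi)).
Proof.
exists (cosimplicial_cgroup V); split=> n i psi; split.
- exact: coface_pushforward.
- by move=> chi; apply: coface_unique; apply: coface_pushforward.
- exact: codegeneracy_pushforward.
- by move=> chi; apply: codegeneracy_unique; apply: codegeneracy_pushforward.
Qed.
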